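(* Let $\nu\in(0,\nu_0]$. For $\ell\in J_1=(0,C_1\nu^\beta]$, $$S_p(\ell)\overset{p}{\sim}\begin{cases}\ell^{p},&0\leq p\leq1,\\ \ell^{p}\nu^{-\beta(p-1)},&p\geq1.\end{cases}$$ On the other hand, for $\ell\in J_2=(C_1\nu^\beta,C_2]$, $$S_p(\ell)\overset{p}{\sim}\begin{cases}\ell^{p},&0\leq p\leq1,\\ \ell,&p\geq1.\end{cases}$$
   Context: Setting. $S^1=\mathbb{R}/\mathbb{Z}$; $\alpha\in(1,2)$ is a fixed constant, $\beta=1/(\alpha-1)$, $\nu\in(0,1]$. $\Lambda=\sqrt{-\Delta}$, so $\Lambda^\alpha$ is the Fourier multiplier by $(2\pi|k|)^\alpha$, $k\in\mathbb{Z}$. The function $f:\mathbb{R}\to\mathbb{R}$ is $C^\infty$, satisfies $f''\geq\sigma>0$ on $\mathbb{R}$, and for each integer $m\geq0$ there are $h(m)\geq0$, $C_m>0$ with $|f^{(m)}(x)|\leq C_m(1+|x|)^{h(m)}$ for all $x\in\mathbb{R}$, where $1\leq h(1)<2$. The initial condition $u_0:S^1\to\mathbb{R}$ is $C^\infty$, has zero mean and is not identically zero; $u=u(t,x)$ is the (global, smooth, zero space average) solution of $$u_t+(f(u))_x+\nu\Lambda^\alpha u=0,\quad t\geq0,\ x\in S^1,\qquad u(0)=u_0.$$ Norms (for zero-mean functions $v$ on $S^1$). $|v|_p$ is the $L_p(S^1)$ norm; $|v|_{m,p}=|d^mv/dx^m|_p$ for integer $m\geq0$; $\|v\|_s=(2\pi)^s\big(\sum_{k\in\mathbb{Z}}|k|^{2s}|\hat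 v^k|^2\big)^{1/2}$ for real $s\geq0$. $D=\max(|u_0|_1^{-1},|u_0|_{1,\infty})>1$. Constants. $X\overset{p}{\lesssim}Y$ means $X\leq CY$ with $C>0$ depending only on $f$, $D$, the fixed constant $\alpha$ and $p$ (in particular independent of $\nu$ and $\ell$); $X\overset{p}{\sim}Y$ means $X\overset{p}{\lesssim}Y$ and $Y\overset{p}{\lesssim}X$. Time average. Fix a constant $\tilde C>0$ depending only on $f,D,\alpha$ such that $\|u(t)\|_{\alpha/2}^2\leq\tilde C\nu^{-1}$ for all $t\geq0$ (such a constant exists). Put $T_1=\frac14D^{-2}\tilde C^{-1}$, $T_2=\max\big(\frac32T_1,\,2D\sigma^{-1}\big)$, and $\lbrace A(t)\rbrace=\frac1{T_2-T_1}\int_{T_1}^{T_2}A(s)\,ds$. Structure functions. $S_p(\ell)=\Big\lbrace\int_{S^1}|u(t,x+\ell)-u(t,x)|^p\,dx\Big\rbrace$ for $p\geq0$, $0<\ell\leq1$. Choice of $C_1,C_2,\nu_0$. For $K>1$ let $L_K$ be the set of $t\in[T_1,T_2]$ such that $K^{-1}\leq|u(t)|_\infty\leq\max_x u_x(t,x)\leq K$, $K^{-1}\nu^{-\beta}\leq|u(t)|_{1,\infty}\leq K\nu^{-\beta}$ and $|u(t)|_{2,\infty}\leq K\nu^{-2\beta}$. There exist constants $C>0$ and $K_1>1$ depending only on $f,D,\alpha$ such that for every $K\geq K_1$ the Lebesgue measure of $L_K$ is at least $C$. Fix such $C$, $K_1$, set $K=K_1$ and $$\nu_0=\Big(\tfrac16K^{-2}\Big)^{1/\beta},\qquad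 C_1=\tfrac14K^{-2},\qquad C_2=\tfrac1{20}K^{-4}.$$ *)

(* Defs.v *)
From mathcomp Require Import all_boot all_order all_algebra.
From mathcomp Require Import all_classical all_reals all_analysis.
From mathcomp Require Import complex.

Set Implicit Arguments.
Unset Strict Implicit.
Unset Printing Implicit Defensive.

Import Order.TTheory GRing.Theory Num.Theory.
Import numFieldNormedType.Exports.

Local Open Scope classical_set_scope.
Local Open Scope ring_scope.

(* Functions on the circle S^1 = R/Z are encoded as 1-periodic functions on
   the real line, and integrals over S^1 as integrals over `[0, 1]. *)
Definition periodic1 (R : realType) (v : R -> R) := forall x, v (x + 1) = v x.

Definition circle_int (R : realType) (v : R -> R) : R :=
  \int[@lebesgue_measure R]_(x in `[0, 1]) v x.

Definition circle_measure (R : realType) :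
    {measure set (measurableTypeR R) -> \bar R} :=
  mrestr (@lebesgue_measure R) (measurable_itv `[0%R, 1%R]).

Definition smooth (R : realType) (v : R -> R) :=
  forall n x, derivable (derive1n n v) x 1.

(* [fine] loses nothing on smooth 1-periodic functions, whose L_p norms are
   finite. *)
Definition norm_Lp (R : realType) (p : \bar R) (v : R -> R) : R :=
  fine ('N[@circle_measure R]_p [EFin \o v])%E.

Definition norm_W (R : realType) (m : nat) (p : \bar R) (v : R -> R) : R :=
  norm_Lp p (derive1n m v).

Definition expi (R : realType) (x : R) : R[i] := Complex (cos x) (sin x).

Definition fourier_coef (R : realType) (v : R -> R) (k : int) : R[i] :=
  Complex (circle_int (fun x => v x * cos (2 * pi * k%:~R * x)))
          (- circle_int (fun x => v x * sin (2 * pi * k%:~R * x))).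

(* ||v||_s; the value is +oo exactly when the series diverges. *)
Definition norm_H (R : realType) (s : R) (v : R -> R) : \bar R :=
  (((2 * pi) `^ s)%R%:E *
   (\esum_(k in [set: int])
      ((`|k%:~R : R| `^ (2 * s) * Normc.normc (fourier_coef v k) ^+ 2)%R)%:E)
     `^ (2^-1)%R)%E.

(* Fourier multiplier by (2 pi |k|)^s, as the limit of the symmetric partial
   sums over -n <= k <= n; these sums are real because v is real valued. *)
Definition Lambda (R : realType) (s : R) (v : R -> R) (x : R) : R :=
  lim ((fun n : nat =>
          complex.Re (\sum_(j < n.*2.+1)
             let k : int := (j : nat)%:Z - n%:Z in
             real_complex R ((2 * pi * `|k%:~R : R|) `^ s)
             * fourier_coef v k * expi (2 * pi * k%:~R * x))) @ \oo).

(* Functions of (t, x) are only meaningful for 0 <= t: the time derivative is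
   taken relatively to [0, +oo[, hence is one-sided at t = 0. *)
Definition dt_filter (R : realType) (t : R) : set_system R :=
  within [set h | 0 <= t + h] (0 : R)^'.

Definition dt_quot (R : realType) (u : R -> R -> R) (t x : R) : R -> R :=
  fun h => h^-1 * (u (t + h) x - u t x).

Definition dt (R : realType) (u : R -> R -> R) : R -> R -> R :=
  fun t x => lim (dt_quot u t x @ dt_filter t).

Definition dx (R : realType) (u : R -> R -> R) : R -> R -> R :=
  fun t x => derive1 (u t) x.

Definition iter_partial (R : realType) (s : seq bool) (u : R -> R -> R) :=
  foldr (fun b v => if b then dt v else dx v) u s.

(* C^oo on [0, +oo[ x R: all iterated partial derivatives, in any order, exist
   and are jointly continuous. *)
Definition smooth_spacetime (R : realType) (u : R -> R -> R) :=
  forall s : seq bool, let w := iter_partial s u in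
  [/\ {within [set z : R * R | 0 <= z.1], continuous (fun z => w z.1 z.2)},
      forall t x : R, 0 <= t -> cvg (dt_quot w t x @ dt_filter t) &
      forall t x : R, 0 <= t -> derivable (w t) x 1].

Definition flux_condition (R : realType) (f : R -> R) (sigma : R) :=
  [/\ smooth f,
      0 < sigma,
      forall x, sigma <= derive1n 2 f x &
      exists h C : nat -> R,
        [/\ forall m, 0 <= h m,
            forall m, 0 < C m,
            forall m x, `|derive1n m f x| <= C m * (1 + `|x|) `^ h m &
            1 <= h 1%N < 2]].

Definition initial_condition (R : realType) (u0 : R -> R) :=
  [/\ periodic1 u0, smooth u0, circle_int u0 = 0 & exists x, u0 x != 0].

Definition D_of (R : realType) (u0 : R -> R) : R :=
  Num.max (norm_Lp 1%E u0)^-1 (norm_W 1 +oo%E u0).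

Definition burgers_solution (R : realType) (alpha : R) (f : R -> R) (nu : R)
    (u0 : R -> R) (u : R -> R -> R) :=
  [/\ forall t : R, 0 <= t -> periodic1 (u t),
      smooth_spacetime u,
      forall t : R, 0 <= t -> circle_int (u t) = 0,
      forall t x : R, 0 <= t ->
        dt u t x + dx (fun s y => f (u s y)) t x
        + nu * Lambda alpha (u t) x = 0 &
      u 0 = u0].

(* The class of (nu, u0, u) over which constants depending only on f, D and
   alpha have to be uniform. *)
Definition admissible (R : realType) (alpha : R) (f : R -> R) (D nu : R)
    (u0 : R -> R) (u : R -> R -> R) :=
  [/\ 0 < nu <= 1, initial_condition u0, D_of u0 = D &
      burgers_solution alpha f nu u0 u].

Definition energy_constant (R : realType) (alpha : R) (f : R -> R)
    (D Ct : R) :=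
  0 < Ct /\
  forall nu u0 u, admissible alpha f D nu u0 u ->
    forall t : R, 0 <= t -> ((norm_H (alpha / 2) (u t)) ^+ 2 <= (Ct * nu^-1)%:E)%E.

Definition beta (R : realType) (alpha : R) : R := 1 / (alpha - 1).

Definition T1 (R : realType) (D Ct : R) : R := 1 / 4 * D ^- 2 * Ct^-1.

Definition T2 (R : realType) (sigma D Ct : R) : R :=
  Num.max (3 / 2 * T1 D Ct) (2 * D * sigma^-1).

Definition time_average (R : realType) (a b : R) (A : R -> R) : R :=
  1 / (b - a) * \int[@lebesgue_measure R]_(s in `[a, b]) A s.

(* [powR] satisfies 0 `^ 0 = 1. *)
Definition structure_function (R : realType) (sigma D Ct : R)
    (u : R -> R -> R) (p l : R) : R :=
  time_average (T1 D Ct) (T2 sigma D Ct)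
    (fun t => circle_int (fun x => `|u t (x + l) - u t x| `^ p)).

Definition L_set (R : realType) (alpha sigma D Ct nu : R) (u : R -> R -> R)
    (K : R) : set R :=
  [set t | [/\ T1 D Ct <= t <= T2 sigma D Ct,
     [/\ K^-1 <= norm_Lp +oo%E (u t),
         norm_Lp +oo%E (u t) <= sup (range (dx u t)) &
         sup (range (dx u t)) <= K],
     K^-1 * nu `^ (- beta alpha) <= norm_W 1 +oo%E (u t)
       <= K * nu `^ (- beta alpha) &
     norm_W 2 +oo%E (u t) <= K * nu `^ (- (2 * beta alpha))]].

Definition L_constants (R : realType) (alpha : R) (f : R -> R)
    (sigma D Ct C K1 : R) :=
  [/\ 0 < C, 1 < K1 &
      forall K, K1 <= K ->
      forall nu u0 u, admissible alpha f D nu u0 u ->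
        (C%:E <= @lebesgue_measure R (L_set alpha sigma D Ct nu u K))%E].

Definition nu_0 (R : realType) (alpha K : R) : R :=
  (1 / 6 * K ^- 2) `^ (1 / beta alpha).

Definition C_1 (R : realType) (K : R) : R := 1 / 4 * K ^- 2.

Definition C_2 (R : realType) (K : R) : R := 1 / 20 * K ^- 4.

Definition sim_with (R : realType) (c X Y : R) := X <= c * Y /\ Y <= c * X.

(* Main.v *)
(** The upper bounds come from maximum principles applied to the increments
    u(t, x+h) - u(t, x), which avoids differentiating the equation.  First,
    u_x <= D for all times, because f is convex and Lambda^alpha is nonnegative
    at a maximum; with the zero mean this bounds the oscillation of u and the
    L_1 norm of u_x.  Second, u_x >= - A nu^(-beta): at a steepest descent the
    nonlinearity contributes at most a multiple of |u_x|^2, while the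
    dissipation is at least nu |u_x|^(1+alpha) / |u|_oo^alpha up to a constant,
    and alpha > 1.  Interpolating increments between L_1 and L_oo gives the
    upper bounds on S_p.

    The lower bounds hold at every time of L_K: on a set of length nu^beta the
    slope is of order nu^(-beta) by the bound on u_xx, and for larger l the drop
    across that set dominates the increment.  For p < 1 the case p = 1 is
    combined with the one-sided bound u_x <= D.  Chebyshev's inequality in time
    concludes. *)
Require Import Defs.
From mathcomp Require Import all_boot all_order all_algebra.
From mathcomp Require Import all_classical all_reals all_analysis.
From mathcomp Require Import ess_sup_inf complex zify ring lra.

Set Implicit Arguments.
Unset Strict Implicit.
Unset Printing Implicit Defensive.

Import Order.TTheory GRing.Theory Num.Theory.
Import numFieldNormedType.Exports.

Local Open Scope classical_set_scope.
Local Open Scope ring_scope.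

(** * Integrals of continuous functions *)

(** The overview relies on the sign and size of [Lambda] at a maximum, which its definition as a
    limit of Fourier sums hides. The bridge is that the integral of (1 - cos (w y)) y^(-1-alpha)
    over (0, +oo) equals [kappa] times w^alpha. It turns [kappa * Lambda] into an integral of second
    differences, nonnegative at a maximum. Reaching it takes two limits, one removing the truncation
    of the kernel and one in the number of Fourier modes, together with pointwise convergence of
    Fourier series of smooth functions. The exponent beta is a balance at a descent of slope -L: the
    nonlinearity is of order L^2 and the dissipation of order nu L^(1+alpha), so the latter wins
    once L^(alpha-1) exceeds a multiple of 1/nu, that is, L exceeds a multiple of nu^(-beta).
    Translations, reflections and dilations of integrals are done through a global antiderivative
    and the fundamental theorem of calculus. This favours integrands continuous on the whole line,
    hence the truncated kernel, and |t| in place of t since the solution has no meaning for t <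
    0. *)

Lemma is_derive_continuous (R : realType) (F f : R -> R) :
  (forall x : R, is_derive x 1 F (f x)) -> continuous F.
Proof.
move=> dF x; apply/differentiable_continuous/derivable1_diffP.
by have [] := dF x.
Qed.

Lemma continuous_add (R : realType) (f g : R -> R) :
  continuous f -> continuous g -> continuous (fun x => f x + g x).
Proof. by move=> cf cg x; exact: cvgD (cf x) (cg x). Qed.

Lemma continuous_sub (R : realType) (f g : R -> R) :
  continuous f -> continuous g -> continuous (fun x => f x - g x).
Proof. by move=> cf cg x; exact: cvgB (cf x) (cg x). Qed.

Lemma continuous_mul (R : realType) (f g : R -> R) :
  continuous f -> continuous g -> continuous (fun x => f x * g x).
Proof. by move=> cf cg x; exact: cvgM (cf x) (cg x). Qed.

Lemma continuous_scale (R : realType) (a : R) (f : R -> R) :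
  continuous f -> continuous (fun x => a * f x).
Proof. by move=> cf x; exact: cvgM (cvg_cst _) (cf x). Qed.

Lemma continuous_const (R : realType) (a : R) : continuous (fun _ : R => a).
Proof. by move=> x; exact: cvg_cst. Qed.

Lemma is_derive_ext (R : realType) (F G : R -> R) (x d : R) :
  F =1 G -> is_derive x 1 F d -> is_derive x 1 G d.
Proof. by move=> /funext ->. Qed.

Lemma is_derive_affine (R : realType) (F : R -> R) (a b x d : R) :
  is_derive (a * x + b) 1 F d ->
  is_derive x 1 (fun y => F (a * y + b)) (d * a).
Proof.
move=> dF.
have dg : is_derive x 1 (fun y : R => a * y + b) a.
  have := @is_deriveD _ _ _ (a \*: id) (cst b) x 1 _ _
    (@is_deriveZ _ _ _ id a x 1 1 (is_derive_id _ _)) (is_derive_cst _ _ _).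
  move=> h; apply: is_derive_eq h _.
  by rewrite addr0 /GRing.scale/= mulr1.
exact: (@is_derive1_comp _ F (fun y => a * y + b) x d a dF dg).
Qed.

Lemma MVT_is_derive (R : realType) (F f : R -> R) (a b : R) :
  (forall x : R, is_derive x 1 F (f x)) -> a <= b ->
  exists2 c, a <= c <= b & F b - F a = f c * (b - a).
Proof.
move=> dF ab; have [|c cab E] := @MVT_segment R F f a b ab (fun x _ => dF x).
  by apply: continuous_subspaceT; exact: is_derive_continuous dF.
by exists c => //; move: cab; rewrite in_itv.
Qed.

Lemma continuous_integrable_itv (R : realType) (w : R -> R) (a b : R) :
  continuous w ->
  (@lebesgue_measure R).-integrable `[a, b] (EFin \o w).
Proof.
move=> cw; apply: continuous_compact_integrable; first exact: segment_compact.
exact: continuous_subspaceT.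
Qed.

Lemma Rintegral_FTC (R : realType) (F f : R -> R) (a b : R) :
  (forall x : R, a <= x <= b -> is_derive x 1 F (f x)) -> continuous f ->
  a <= b ->
  \int[@lebesgue_measure R]_(x in `[a, b]) f x = F b - F a.
Proof.
move=> dF cf ab; have [dFa dFb] : is_derive a 1 F (f a) /\ is_derive b 1 F (f b).
  by split; apply: dF; rewrite lexx ab.
have cont (x : R) : is_derive x 1 F (f x) -> {for x, continuous F}.
  by move=> [h _]; exact/differentiable_continuous/derivable1_diffP.
move: ab; rewrite le_eqVlt => /predU1P[->|ab].
  by rewrite set_itv1 Rintegral_set1 subrr.
rewrite /Rintegral (@continuous_FTC2 _ f F)//.
- exact: continuous_subspaceT.
- split.
  + move=> x; rewrite in_itv/= => /andP[ax xb].
    by have [|h _] := dF x; rewrite ?(ltW ax) ?(ltW xb)//; exact: h.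
  + exact: cvg_at_right_filter (cont _ dFa).
  + exact: cvg_at_left_filter (cont _ dFb).
- move=> x; rewrite in_itv/= => /andP[ax xb].
  by have [|_ h] := dF x; rewrite ?(ltW ax) ?(ltW xb)// derive1E; exact: h.
Qed.

(** A primitive on the whole line reduces the later changes of variables to algebra on the values of
    the primitive. *)
Lemma continuous_antiderivative (R : realType) (f : R -> R) :
  continuous f -> exists F : R -> R, forall x : R, is_derive x 1 F (f x).
Proof.
move=> cf.
pose mu := @lebesgue_measure R.
pose I a x := \int[mu]_(t in `[a, x]) f t.
have dI a (x : R) : a < x -> is_derive x 1 (I a) (f x).
  move=> ax.
  have x1 : x < x + 1 by rewrite ltrDl.
  have [d1 d2] := continuous_FTC1_closed x1 (continuous_integrable_itv a _ cf) ax (cf x).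
  by split; [exact: d1|rewrite -derive1E; exact: d2].
have chasles a b x : a <= b -> b <= x -> I a x = I a b + I b x.
  move=> ab bx.
  have := @Rintegral_itvB R f (BLeft a) (BRight x) b.
  rewrite !bnd_simp => /(_ (continuous_integrable_itv _ _ cf) ab bx) E.
  rewrite /I addrC; apply/eqP; rewrite -subr_eq; apply/eqP; rewrite E.
  by apply: Rintegral_itv_obnd_cbnd; apply: integrableS (continuous_integrable_itv b x cf) => //;
    apply: subset_itvr; rewrite bnd_simp.
(* For x < 0 the interval [[0, x]] is empty, so the integral from 0 has to be split by sign. Near
   each x, [F] differs by a constant from an integral based at a point left of both x and 0, where
   the fundamental theorem applies. *)
pose F x := if 0 <= x then I 0 x else - I x 0.
have FE a x : a < x -> a < 0 -> F x = I a x - I a 0.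
  move=> ax a0; rewrite /F; case: ifPn => [x0|].
    by rewrite (chasles a 0 x (ltW a0) x0) addrC addKr.
  rewrite -ltNge => x0.
  by rewrite (chasles a x 0 (ltW ax) (ltW x0)) opprD addNKr.
exists F => x.
pose a := Num.min x 0 - 1.
have ax : a < x by rewrite /a ltrBlDr gt_min ltrDl ltr01.
have a0 : a < 0 by rewrite /a ltrBlDr gt_min ltrDl ltr01 orbT.
apply: (@near_eq_is_derive _ _ _ (fun x => I a x - I a 0)).
  near=> y; apply/esym/FE => //; near: y; exact: lt_nbhsr.
have := @is_deriveB _ _ _ (I a) (cst (I a 0)) x 1 _ _ (dI a x ax) (is_derive_cst _ _ _).
by rewrite subr0.
Unshelve. all: by end_near. Qed.

(** For a primitive [W], the increment W (z + 1) - W z has zero derivative by periodicity, hence the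
    same value at y and at 0. *)
Lemma Rintegral_periodic_shift (R : realType) (w : R -> R) (y : R) :
  continuous w -> periodic1 w ->
  circle_int (fun z => w (z + y)) = circle_int w.
Proof.
move=> cw pw; have [W dW] := continuous_antiderivative cw.
have dWy (b x : R) : is_derive x 1 (fun z : R => W (z + b)) (w (x + b)).
  have := @is_derive_affine R W 1 b x (w (1 * x + b)) (dW _).
  by rewrite mulr1 mul1r; apply: is_derive_ext => z; rewrite mul1r.
rewrite /circle_int.
rewrite (@Rintegral_FTC R (fun z => W (z + y)) (fun z => w (z + y)) 0 1 (fun x _ => dWy y x))//.
- rewrite (Rintegral_FTC (fun x _ => dW x))// add0r.
  pose H z := W (z + 1) - W z.
  have dH (x : R) : is_derive x 1 H 0.
    have := @is_deriveB _ _ _ (fun z : R => W (z + 1)) W x 1 _ _ (dWy 1 x) (dW x).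
    by rewrite pw subrr.
  have := is_derive_0_is_cst y 0 dH; rewrite /H add0r => <-.
  by rewrite [1 + y]addrC.
- move=> z; apply: continuous_comp; last exact: cw.
  by apply: cvgD; [exact: cvg_id|exact: cvg_cst].
Qed.

Lemma Rintegral_periodic_opp (R : realType) (w : R -> R) :
  continuous w -> periodic1 w ->
  circle_int (fun z => w (- z)) = circle_int w.
Proof.
move=> cw pw; rewrite -(Rintegral_periodic_shift (- 1) cw pw).
have [W dW] := continuous_antiderivative cw.
have dV (x : R) : is_derive x 1 (fun z : R => - W (-1 * z + 0)) (w (- x)).
  have h := @is_derive_affine R W (-1) 0 x (w (-1 * x + 0)) (dW _).
  have := is_deriveN h; rewrite mulrN1 opprK.
  by rewrite addr0 mulN1r.
have dV' (x : R) : is_derive x 1 (fun z : R => W (1 * z + -1)) (w (x - 1)).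
  have := @is_derive_affine R W 1 (-1) x (w (1 * x + -1)) (dW _).
  by rewrite mulr1 mul1r.
rewrite /circle_int (Rintegral_FTC (fun x _ => dV x))//; last first.
  by move=> x; apply: continuous_comp; [exact: opp_continuous|exact: cw].
rewrite (Rintegral_FTC (fun x _ => dV' x))//; last first.
  by move=> x; apply: continuous_comp; [apply: cvgB; [exact: cvg_id|exact: cvg_cst]|exact: cw].
rewrite !mulr1 !mulr0 !addr0 !add0r subrr opprK addrC.
by [].
Qed.

Lemma le_Rintegral_itv (R : realType) (f g : R -> R) (a b : R) :
  continuous f -> continuous g -> (forall x, a <= x <= b -> f x <= g x) ->
  \int[@lebesgue_measure R]_(x in `[a, b]) f x <=
  \int[@lebesgue_measure R]_(x in `[a, b]) g x.
Proof.
move=> cf cg fg; apply: le_Rintegral => //; try exact: continuous_integrable_itv.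
Qed.

Lemma RintegralD_itv (R : realType) (f g : R -> R) (a b : R) :
  continuous f -> continuous g ->
  \int[@lebesgue_measure R]_(x in `[a, b]) (f x + g x) =
  \int[@lebesgue_measure R]_(x in `[a, b]) f x +
  \int[@lebesgue_measure R]_(x in `[a, b]) g x.
Proof.
by move=> cf cg; apply: RintegralD => //; exact: continuous_integrable_itv.
Qed.

Lemma RintegralZ_itv (R : realType) (f : R -> R) (c a b : R) : continuous f ->
  \int[@lebesgue_measure R]_(x in `[a, b]) (c * f x) =
  c * \int[@lebesgue_measure R]_(x in `[a, b]) f x.
Proof.
by move=> cf; apply: RintegralZl => //; exact: continuous_integrable_itv.
Qed.

Lemma Rintegral_itv_cst (R : realType) (c a b : R) : a <= b ->
  \int[@lebesgue_measure R]_(x in `[a, b]) c = c * (b - a).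
Proof.
move=> ab; rewrite Rintegral_cst//= lebesgue_measure_itv/= lte_fin.
by case: ltP => [//|ba]/=; have -> : a = b; rewrite ?subrr//; apply/eqP; rewrite eq_le ab.
Qed.

Lemma continuous_bigsum (R : realType) (I : Type) (s : seq I) (f : I -> R -> R) :
  (forall i, continuous (f i)) -> continuous (fun x => \sum_(i <- s) f i x).
Proof.
move=> cf; elim: s => [|i s IH] x.
  under [X in continuous_at _ X]eq_fun do rewrite big_nil.
  exact: cvg_cst.
under [X in continuous_at _ X]eq_fun do rewrite big_cons.
by apply: cvgD; [exact: cf|exact: IH].
Qed.

Lemma Rintegral_sum_itv (R : realType) (I : Type) (s : seq I) (f : I -> R -> R)
    (a b : R) : (forall i, continuous (f i)) ->
  \int[@lebesgue_measure R]_(x in `[a, b]) (\sum_(i <- s) f i x) =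
  \sum_(i <- s) \int[@lebesgue_measure R]_(x in `[a, b]) f i x.
Proof.
move=> cf; elim: s => [|i s IH].
  under eq_Rintegral do rewrite big_nil.
  by rewrite big_nil Rintegral_cst// mul0r.
under eq_Rintegral do rewrite big_cons.
rewrite big_cons RintegralD_itv ?IH//.
exact: continuous_bigsum.
Qed.

Lemma Rintegral_chasles (R : realType) (f : R -> R) (a b c : R) :
  continuous f -> a <= b -> b <= c ->
  \int[@lebesgue_measure R]_(x in `[a, c]) f x =
  \int[@lebesgue_measure R]_(x in `[a, b]) f x +
  \int[@lebesgue_measure R]_(x in `[b, c]) f x.
Proof.
move=> cf ab bc; have [F dF] := continuous_antiderivative cf.
rewrite !(Rintegral_FTC (fun x _ => dF x))//; last exact: le_trans bc.
by ring.
Qed.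

Lemma Rintegral_ge0_itv (R : realType) (f : R -> R) (a b : R) :
  (forall x, a <= x <= b -> 0 <= f x) ->
  0 <= \int[@lebesgue_measure R]_(x in `[a, b]) f x.
Proof. by move=> f0; apply: Rintegral_ge0 => x /=; rewrite in_itv; exact: f0. Qed.

Lemma Rintegral_subset_itv (R : realType) (f : R -> R) (a b c d : R) :
  continuous f -> a <= c -> c <= d -> d <= b ->
  (forall x, a <= x <= b -> 0 <= f x) ->
  \int[@lebesgue_measure R]_(x in `[c, d]) f x <=
  \int[@lebesgue_measure R]_(x in `[a, b]) f x.
Proof.
move=> cf ac cd db f0.
rewrite (Rintegral_chasles cf ac (le_trans cd db)) (Rintegral_chasles cf cd db).
rewrite addrCA lerDl addr_ge0// Rintegral_ge0_itv// => x /andP[x1 x2]; apply: f0.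
- by rewrite x1 (le_trans x2)// (le_trans cd).
- by rewrite x2 andbT (le_trans _ x1)// (le_trans ac).
Qed.

(** * The kernel y^(-1-alpha) *)

Lemma continuous_cosM (R : realType) (a : R) : continuous (fun y : R => cos (a * y)).
Proof.
move=> y; apply: (continuous_comp (f := fun y : R => a * y)); last exact: continuous_cos.
exact: mulrl_continuous.
Qed.

Lemma norm_sin_le (R : realType) (x : R) : `|sin x| <= `|x|.
Proof.
wlog x0 : x / 0 <= x.
  move=> H; have [|/ltW x0] := leP 0 x; first exact: H.
  by rewrite -normrN -[`|x|]normrN -sinN; apply: H; rewrite oppr_ge0.
have [c _] := MVT_is_derive (fun y => is_derive_sin y) x0.
rewrite sin0 !subr0 => ->; rewrite normrM ler_piMl//.
by rewrite ler_norml cos_geN1 cos_le1.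
Qed.

Lemma oneBcos (R : realType) (x : R) : 1 - cos x = 2 * sin (x / 2) ^+ 2.
Proof.
have {1}-> : x = (x / 2) *+ 2 by rewrite -mulr_natr divfK// pnatr_eq0.
by rewrite cos_mulr2n sin2cos2; ring.
Qed.

Lemma oneBcos_le (R : realType) (x : R) : 1 - cos x <= x ^+ 2 / 2.
Proof.
have h : sin (x / 2) ^+ 2 <= (x / 2) ^+ 2.
  by rewrite -real_normK ?num_real// -[leRHS]real_normK ?num_real// lerXn2r ?nnegrE ?norm_sin_le.
by rewrite oneBcos; lra.
Qed.

Lemma oneBcos_ge0 (R : realType) (x : R) : 0 <= 1 - cos x.
Proof. by rewrite subr_ge0 cos_le1. Qed.

Lemma oneBcos_le2 (R : realType) (x : R) : 1 - cos x <= 2.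
Proof. by have := cos_geN1 x; lra. Qed.

(* The truncation at d makes the singular kernel y^(-1-alpha) continuous on R. *)
Definition kern (R : realType) (alpha d y : R) : R :=
  Num.max y d `^ (- (1 + alpha)).

Lemma continuous_powR_max (R : realType) (d s : R) : 0 < d ->
  continuous (fun y : R => Num.max y d `^ s).
Proof.
move=> d0 y; apply: (@continuous_comp R R R (fun y : R => Num.max y d) (fun z => z `^ s)).
  by apply: continuous_max; [exact: cvg_id|exact: cvg_cst].
apply/differentiable_continuous/derivable1_diffP/derivable_powR.
by rewrite in_itv/= andbT lt_max d0 orbT.
Qed.

Lemma continuous_kern (R : realType) (alpha d : R) : 0 < d ->
  continuous (kern alpha d).
Proof. exact: continuous_powR_max. Qed.

Lemma kern_ge0 (R : realType) (alpha d y : R) : 0 <= kern alpha d y.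
Proof. exact: powR_ge0. Qed.

Lemma kernE (R : realType) (alpha d y : R) : d <= y ->
  kern alpha d y = y `^ (- (1 + alpha)).
Proof. by move=> dy; rewrite /kern max_l. Qed.

(** Envelope of 1 - cos, up to constants: quadratic at 0 and bounded at infinity, hence integrable
    against y^(-1-alpha) on (0, +oo). *)
Definition min1sqr (R : realType) (y : R) : R := Num.min 1 (y ^+ 2).

Lemma continuous_min1sqr (R : realType) : continuous (@min1sqr R).
Proof.
move=> y; apply: (@continuous_min _ _ (fun=> 1) (fun y : R => y ^+ 2)).
  exact: cvg_cst.
exact: exprn_continuous.
Qed.

Lemma min1sqr_ge0 (R : realType) (y : R) : 0 <= min1sqr y.
Proof. by rewrite le_min ler01 sqr_ge0. Qed.

Lemma is_derive_powR_div (R : realType) (s x : R) : s != 0 -> 0 < x ->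
  is_derive x 1 (fun y : R => s^-1 * y `^ s) (x `^ (s - 1)).
Proof.
move=> s0 x0; have h := @is_deriveZ _ _ _ ((@powR R) ^~ s) s^-1 x 1 _ (is_derive1_powR s x0).
by apply: is_derive_eq h _; rewrite /GRing.scale/= mulKf.
Qed.

(** The bound does not depend on a and b. The integrand is nonnegative, so the interval may be
    enlarged to contain 1; the part below 1 is controlled by alpha < 2 and the part above 1 by alpha
    > 0. *)
Lemma Rintegral_min1sqr_kern (R : realType) (alpha a b : R) :
  1 < alpha < 2 -> 0 < a -> a <= b ->
  \int[@lebesgue_measure R]_(y in `[a, b]) (min1sqr y * kern alpha a y) <=
  (2 - alpha)^-1 + alpha^-1.
Proof.
move=> /andP[al1 al2] a0 ab.
pose a' := Num.min a 1; pose b' := Num.max b 1.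
have a'0 : 0 < a' by rewrite lt_min a0 ltr01.
have a'1 : a' <= 1 by rewrite ge_min lexx orbT.
have b'1 : 1 <= b' by rewrite le_max lexx orbT.
have a'a : a' <= a by rewrite ge_min lexx.
have b'b : b <= b' by rewrite le_max lexx.
pose g d y := @min1sqr R y * kern alpha d y.
have cg d : 0 < d -> continuous (g d).
  by move=> d0 y; apply: cvgM; [exact: continuous_min1sqr|exact: continuous_kern].
have g0 d y : 0 <= g d y by rewrite mulr_ge0 ?min1sqr_ge0 ?kern_ge0.
have -> : \int[@lebesgue_measure R]_(y in `[a, b]) (min1sqr y * kern alpha a y) =
    \int[@lebesgue_measure R]_(y in `[a, b]) (g a' y).
  apply: eq_Rintegral => y; rewrite inE/= in_itv/= => /andP[ay _].
  by rewrite /g !kernE// (le_trans a'a).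
apply: le_trans (Rintegral_subset_itv (cg _ a'0) a'a ab b'b (fun y _ => g0 a' y)) _.
rewrite (Rintegral_chasles (cg _ a'0) a'1 b'1); apply: lerD.
- have dF (x : R) : a' <= x <= 1 ->
      is_derive x 1 (fun y => (2 - alpha)^-1 * y `^ (2 - alpha)) (g a' x).
    move=> /andP[ax x1]; have x0 : 0 < x := lt_le_trans a'0 ax.
    have s0 : 2 - alpha != 0 by rewrite subr_eq0 gt_eqF.
    apply: is_derive_eq (is_derive_powR_div s0 x0) _.
    rewrite /g kernE// /min1sqr min_r ?exprn_ile1 ?(ltW x0)//.
    rewrite -powR_mulrn ?(ltW x0)// -powRD ?(gt_eqF x0) ?implybT//.
    by congr (_ `^ _); ring.
  rewrite (Rintegral_FTC dF (cg _ a'0) a'1) powR1 mulr1 gerBl.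
  by rewrite mulr_ge0 ?powR_ge0// invr_ge0 subr_ge0 ltW.
- have dF (x : R) : 1 <= x <= b' ->
      is_derive x 1 (fun y => (- alpha)^-1 * y `^ (- alpha)) (g a' x).
    move=> /andP[x1 xb]; have x0 : 0 < x := lt_le_trans ltr01 x1.
    have s0 : - alpha != 0 by rewrite oppr_eq0 gt_eqF// (lt_trans _ al1).
    apply: is_derive_eq (is_derive_powR_div s0 x0) _.
    rewrite /g kernE ?(le_trans a'1)// /min1sqr min_l ?mul1r; last by rewrite exprn_ege1.
    by congr (_ `^ _); ring.
  rewrite (Rintegral_FTC dF (cg _ a'0) b'1) powR1 mulr1.
  rewrite invrN !mulNr opprK addrC gerDl oppr_le0.
  by rewrite mulr_ge0 ?powR_ge0// invr_ge0 ltW// (lt_trans _ al1).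
Qed.

(** Truncating at the left endpoint [a] changes nothing on the interval of integration: the
    integrand is (1 - cos y) y^(-1-alpha) there. *)
Definition Phi (R : realType) (alpha a b : R) : R :=
  \int[@lebesgue_measure R]_(y in `[a, b]) ((1 - cos y) * kern alpha a y).

Lemma continuous_cos_kern (R : realType) (alpha a d : R) : 0 < d ->
  continuous (fun y : R => (1 - cos (a * y)) * kern alpha d y).
Proof.
move=> d0 y; apply: cvgM; last exact: continuous_kern.
by apply: cvgB; [exact: cvg_cst|exact: continuous_cosM].
Qed.

Lemma Phi_mono (R : realType) (alpha a b c d : R) :
  0 < a -> a <= c -> c <= d -> d <= b -> Phi alpha c d <= Phi alpha a b.
Proof.
move=> a0 ac cd db; have cf := @continuous_cos_kern R alpha 1 a a0.
have cf' : continuous (fun y : R => (1 - cos y) * kern alpha a y).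
  by under eq_fun do rewrite -[y in cos y]mul1r.
rewrite /Phi; have -> : \int[@lebesgue_measure R]_(y in `[c, d]) ((1 - cos y) * kern alpha c y)
  = \int[@lebesgue_measure R]_(y in `[c, d]) ((1 - cos y) * kern alpha a y).
  apply: eq_Rintegral => y; rewrite inE/= in_itv/= => /andP[cy _].
  by rewrite !kernE// (le_trans ac).
apply: Rintegral_subset_itv => // y _.
by rewrite mulr_ge0 ?kern_ge0 ?oneBcos_ge0.
Qed.

Lemma Phi_le (R : realType) (alpha a b : R) :
  1 < alpha < 2 -> 0 < a -> a <= b ->
  Phi alpha a b <= 2 * ((2 - alpha)^-1 + alpha^-1).
Proof.
move=> al a0 ab; have cf := @continuous_cos_kern R alpha 1 a a0.
have cf' : continuous (fun y : R => (1 - cos y) * kern alpha a y).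
  by under eq_fun do rewrite -[y in cos y]mul1r.
have cg : continuous (fun y : R => min1sqr y * kern alpha a y).
  by move=> y; apply: cvgM; [exact: continuous_min1sqr|exact: continuous_kern].
apply: le_trans (ler_wpM2l _ (Rintegral_min1sqr_kern al a0 ab)) => //.
rewrite -RintegralZ_itv//; apply: le_Rintegral_itv => //.
  by move=> y; apply: cvgM; [exact: cvg_cst|exact: cg].
move=> y _; rewrite mulrA ler_wpM2r ?kern_ge0//.
rewrite /min1sqr; case: (leP 1 (y ^+ 2)) => _; first by rewrite mulr1 oneBcos_le2.
by apply: le_trans (oneBcos_le _) _; have := sqr_ge0 y; lra.
Qed.

Definition Phi_set (R : realType) (alpha : R) : set R :=
  [set Phi alpha ab.1 ab.2 | ab in [set ab : R * R | 0 < ab.1 <= ab.2]].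

(* kappa is the improper integral of (1 - cos y) y^(-1-alpha) over (0, +oo);
   the integrals Phi over [a, b] increase to it. *)
Definition kappa (R : realType) (alpha : R) : R := sup (Phi_set alpha).

Lemma has_sup_Phi (R : realType) (alpha : R) : 1 < alpha < 2 ->
  has_sup (Phi_set alpha).
Proof.
move=> al; split.
  by exists (Phi alpha 1 1); exists (1, 1) => //=; rewrite ltr01 lexx.
exists (2 * ((2 - alpha)^-1 + alpha^-1)) => _ [[a b] /= /andP[a0 ab] <-].
exact: Phi_le.
Qed.

Lemma Phi_le_kappa (R : realType) (alpha a b : R) : 1 < alpha < 2 ->
  0 < a -> a <= b -> Phi alpha a b <= kappa alpha.
Proof.
move=> al a0 ab; apply: ub_le_sup; first by have [] := has_sup_Phi al.
by exists (a, b) => //=; rewrite a0.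
Qed.

Lemma kappa_gt0 (R : realType) (alpha : R) : 1 < alpha < 2 -> 0 < kappa alpha.
Proof.
move=> al; apply: lt_le_trans (Phi_le_kappa al ltr01 (ler1n _ 2)).
have c1 : cos 1 < 1 :> R.
  rewrite -[ltRHS]cos0 ltr_cos ?ltr01// in_itv/= ?lexx ?ler01 ?pi_ge0//.
  by rewrite (le_trans _ (pi_ge2 R))// ler1n.
apply: (@lt_le_trans _ _ ((1 - cos 1) * 2 `^ (- (1 + alpha)) * (2 - 1))).
  by rewrite !mulr_gt0 ?subr_gt0 ?powR_gt0// ltr1n.
have cf := @continuous_cos_kern R alpha 1 1 ltr01.
have cf' : continuous (fun y : R => (1 - cos y) * kern alpha 1 y).
  by under eq_fun do rewrite -[y in cos y]mul1r.
rewrite -(@Rintegral_itv_cst R ((1 - cos 1) * 2 `^ (- (1 + alpha))) 1 2 (ler1n _ 2)); apply: le_Rintegral_itv => //.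
  by move=> y; exact: cvg_cst.
move=> y /andP[y1 y2]; rewrite ler_pM ?powR_ge0 ?oneBcos_ge0//.
  rewrite lerB// leNgt; apply/negP.
  by rewrite ltr_cos ?in_itv/= ?ltNge ?y1// ?ler01 ?(le_trans _ y1)//= ?(le_trans y2)// ?(le_trans _ (pi_ge2 R))// ?ler1n.
rewrite kernE// !powRN lef_pV2 ?posrE ?powR_gt0 ?(lt_le_trans ltr01)//.
case/andP: al => al1 _; have s0 : 0 <= 1 + alpha by lra.
by apply: ge0_ler_powR; rewrite ?nnegrE ?ler0n ?(le_trans ler01 y1).
by rewrite ler1n.
Qed.

(** The substitution y -> l y. For l = 2 pi k the factor l^alpha is the multiplier of [Lambda],
    which links the singular integral to the Fourier definition. *)
Lemma Rintegral_kern_scaling (R : realType) (alpha l a b : R) :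
  0 < l -> 0 < a -> a <= b ->
  \int[@lebesgue_measure R]_(y in `[a, b]) ((1 - cos (l * y)) * kern alpha a y) =
  l `^ alpha * Phi alpha (l * a) (l * b).
Proof.
move=> l0 a0 ab; have la0 : 0 < l * a by rewrite mulr_gt0.
have cf' : continuous (fun y : R => (1 - cos y) * kern alpha (l * a) y).
  by under eq_fun do rewrite -[y in cos y]mul1r; exact: continuous_cos_kern.
have [W dW] := continuous_antiderivative cf'.
rewrite /Phi (Rintegral_FTC (fun x _ => dW x))// ?ler_pM2l// mulrBr.
have dF (x : R) : a <= x <= b -> is_derive x 1 (fun y => l `^ alpha * W (l * y))
    ((1 - cos (l * x)) * kern alpha a x).
  move=> /andP[ax xb]; have x0 : 0 < x := lt_le_trans a0 ax.
  have h : is_derive x 1 (fun y => W (l * y))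
      ((1 - cos (l * x)) * kern alpha (l * a) (l * x) * l).
    have := @is_derive_affine R W l 0 x _ (dW (l * x + 0)).
    by rewrite addr0; apply: is_derive_ext => y; rewrite addr0.
  apply: is_derive_eq (@is_deriveZ _ _ _ _ (l `^ alpha) _ _ _ h) _.
  rewrite /GRing.scale/= !kernE ?ler_pM2l// powRM ?ltW// !powRN powRD ?(gt_eqF l0) ?implybT//.
  rewrite powRr1 ?ltW//; set L := l `^ alpha.
  have L0 : L != 0 by rewrite gt_eqF ?powR_gt0.
  rewrite powRD ?(gt_eqF x0) ?implybT// powRr1 ?ltW//.
  have X0 : x `^ alpha != 0 by rewrite gt_eqF ?powR_gt0.
  by field; rewrite L0 X0 !gt_eqF.
by rewrite (Rintegral_FTC dF (@continuous_cos_kern _ alpha l _ a0) ab).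
Qed.

Lemma cvg_Phi (R : realType) (alpha l : R) : 1 < alpha < 2 -> 0 < l ->
  Phi alpha (l * j.+1%:R^-1) (l * j.+1%:R) @[j --> \oo] --> kappa alpha.
Proof.
move=> al l0; apply/cvgrPdist_le => e e0.
have [_ [[a b]/= /andP[a0 ab] <-] eab] := sup_adherent e0 (has_sup_Phi al).
rewrite -/(kappa alpha) in eab.
near=> j.
have j0 : 0 < j.+1%:R :> R by rewrite ltr0n.
have ja : l * j.+1%:R^-1 <= a.
  rewrite ler_pdivrMr// mulrC -ler_pdivrMr// (@le_trans _ _ j%:R) ?ler_nat//.
  by near: j; exact: nbhs_infty_ger.
have jb : b <= l * j.+1%:R.
  rewrite mulrC -ler_pdivrMr// (@le_trans _ _ j%:R) ?ler_nat//.
  by near: j; exact: nbhs_infty_ger.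
have h1 : Phi alpha (l * j.+1%:R^-1) (l * j.+1%:R) <= kappa alpha.
  apply: Phi_le_kappa => //; first by rewrite mulr_gt0 ?invr_gt0.
  exact: le_trans (le_trans ja ab) jb.
rewrite ger0_norm; last by rewrite subr_ge0.
rewrite lerBlDl -lerBlDr; apply: le_trans (ltW eab) _.
by apply: Phi_mono => //; rewrite mulr_gt0 ?invr_gt0.
Unshelve. all: by end_near. Qed.

(** * Fourier series of smooth periodic functions *)

Lemma smooth_is_derive (R : realType) (v : R -> R) (n : nat) (x : R) :
  smooth v -> is_derive x 1 (derive1n n v) (derive1n n.+1 v x).
Proof.
by move=> sv; split; [exact: sv|rewrite derive1nS derive1E].
Qed.

Lemma smooth_chain (R : realType) (v : R -> R) (V : nat -> R -> R) :
  V 0%N = v -> (forall n (x : R), is_derive x 1 (V n) (V n.+1 x)) -> smooth v.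
Proof.
move=> V0 dV; suff E n : derive1n n v = V n by move=> n x; rewrite E; have [] := dV n x.
elim: n => [|n IH]; first by rewrite derive1n0.
by rewrite derive1nS IH; apply/funext => x; rewrite derive1E; have [] := dV n x.
Qed.

Lemma smooth_continuous (R : realType) (v : R -> R) (n : nat) :
  smooth v -> continuous (derive1n n v).
Proof.
move=> sv; apply: (@is_derive_continuous _ _ (derive1n n.+1 v)) => x.
exact: smooth_is_derive.
Qed.

Lemma periodic_derive1n (R : realType) (v : R -> R) (n : nat) :
  periodic1 v -> periodic1 (derive1n n v).
Proof.
move=> pv; elim: n => [//|n IH] x; rewrite derive1nS.
set w := derive1n n v in IH *; rewrite /derive1.
suff -> : (fun h : R => h^-1 *: (w (h + (x + 1)) - w (x + 1))) =
          (fun h : R => h^-1 *: (w (h + x) - w x)) by [].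
by apply/funext => h; rewrite addrA !IH.
Qed.

Lemma periodicZ (R : realType) (v : R -> R) (k : int) (x : R) :
  periodic1 v -> v (x + k%:~R) = v x.
Proof.
move=> pv; have nat_case (n : nat) y : v (y + n%:R) = v y.
  elim: n y => [|n IH] y; first by rewrite addr0.
  by rewrite -natr1 addrA pv IH.
case: (intP k) => [|n|n]; first by rewrite addr0.
- by rewrite -pmulrn nat_case.
- by rewrite -(nat_case n.+1) rmorphN/= -pmulrn subrK.
Qed.

Lemma periodic_reduce (R : realType) (x : R) :
  exists k : int, 0 <= x + k%:~R <= 1.
Proof.
exists (- Num.floor x); rewrite rmorphN/=.
by have := floor_itv x; rewrite intrD => /andP[h1 h2]; apply/andP; split; lra.
Qed.

Lemma periodic_max (R : realType) (v : R -> R) : continuous v -> periodic1 v ->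
  exists c, forall x, v x <= v c.
Proof.
move=> cv pv.
have [c _ cmax] := EVT_max (@ler01 R) (continuous_subspaceT cv).
exists c => x; have [k k01] := periodic_reduce x.
by rewrite -(periodicZ k x pv); apply: cmax; rewrite in_itv.
Qed.

Lemma periodic_bounded (R : realType) (v : R -> R) :
  continuous v -> periodic1 v -> exists2 M, 0 <= M & forall x, `|v x| <= M.
Proof.
move=> cv pv; have [|x|c cmax] := @periodic_max R (fun x => `|v x|).
- by move=> x; apply: cvg_norm; exact: cv.
- by rewrite pv.
- by exists `|v c|.
Qed.

(* The k-th term of the Fourier series of v at x is, up to the factor 2 for
   k > 0, the k-th cosine coefficient of v recentred at x. *)
Definition cosc (R : realType) (v : R -> R) (k : nat) (x : R) : R :=
  circle_int (fun z => v (x + z) * cos (2 * pi * k%:R * z)).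

Lemma cos_2pik (R : realType) (k : nat) (x : R) :
  cos (2 * pi * k%:R * (x + 1)) = cos (2 * pi * k%:R * x).
Proof.
rewrite mulrDr mulr1 -(periodicn (@cosD2pi R) k (2 * pi * k%:R * x)).
by congr (cos (_ + _)); rewrite mulr_natr mulr_natl.
Qed.

Lemma sin_2pik (R : realType) (k : nat) (x : R) :
  sin (2 * pi * k%:R * (x + 1)) = sin (2 * pi * k%:R * x).
Proof.
rewrite mulrDr mulr1 -(periodicn (@sinD2pi R) k (2 * pi * k%:R * x)).
by congr (sin (_ + _)); rewrite mulr_natr mulr_natl.
Qed.

Lemma continuous_comp_addr (R : realType) (v : R -> R) (x : R) :
  continuous v -> continuous (fun z => v (x + z)).
Proof.
move=> cv z; apply: continuous_comp; last exact: cv.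
by apply: cvgD; [exact: cvg_cst|exact: cvg_id].
Qed.

Lemma continuous_comp_subr (R : realType) (v : R -> R) (x : R) :
  continuous v -> continuous (fun z => v (x - z)).
Proof.
move=> cv z; apply: continuous_comp; last exact: cv.
by apply: cvgB; [exact: cvg_cst|exact: cvg_id].
Qed.

Lemma continuous_mulcos (R : realType) (v : R -> R) (a : R) :
  continuous v -> continuous (fun z => v z * cos (a * z)).
Proof. by move=> cv z; apply: cvgM; [exact: cv|exact: continuous_cosM]. Qed.

Lemma cosc_refl (R : realType) (v : R -> R) (k : nat) (x : R) :
  continuous v -> periodic1 v ->
  circle_int (fun z => v (x - z) * cos (2 * pi * k%:R * z)) = cosc v k x.
Proof.
move=> cv pv; rewrite /cosc.
rewrite -[RHS]Rintegral_periodic_opp; first last.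
- by move=> z; rewrite addrA pv cos_2pik.
- exact/continuous_mulcos/continuous_comp_addr.
by congr circle_int; apply/funext => z; rewrite mulrN cosN.
Qed.

Lemma circle_int_cst (R : realType) (c : R) : circle_int (fun=> c) = c.
Proof. by rewrite /circle_int Rintegral_itv_cst// subr0 mulr1. Qed.

Lemma cosc_cst (R : realType) (c : R) (k : nat) (x : R) :
  cosc (fun=> c) k x = if k == 0%N then c else 0.
Proof.
rewrite /cosc /circle_int; case: eqP => [->|/eqP k0].
  under eq_Rintegral do rewrite mulr0 mul0r cos0 mulr1.
  exact: circle_int_cst.
have w0 : 2 * pi * k%:R != 0 :> R by rewrite !mulf_neq0 ?gt_eqF ?pi_gt0 ?ltr0n ?lt0n.
set w := 2 * pi * k%:R in w0 *.
have dF (z : R) : is_derive z 1 (fun z => c / w * sin (w * z + 0)) (c * cos (w * z)).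
  have h := @is_derive_affine R sin w 0 z _ (is_derive_sin _).
  apply: is_derive_eq (@is_deriveZ _ _ _ _ (c / w) _ _ _ h) _.
  by rewrite addr0 /GRing.scale/=; field.
rewrite (Rintegral_FTC (fun z _ => dF z))//; last first.
  exact: (@continuous_mulcos _ (fun=> c) w (fun z => cvg_cst c)).
by have := @sin_2pik R k 0; rewrite -/w add0r !addr0 => ->; rewrite subrr.
Qed.

Lemma cosc_le (R : realType) (v : R -> R) (M : R) (k : nat) (x : R) :
  continuous v -> (forall y, `|v y| <= M) -> `|cosc v k x| <= M.
Proof.
move=> cv vM; have cw := @continuous_mulcos _ _ (2 * pi * k%:R) (@continuous_comp_addr _ _ x cv).
rewrite /cosc /circle_int.
apply: le_trans (le_normr_Rintegral _ (continuous_integrable_itv _ _ cw)) _ => //.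
rewrite -[leRHS]circle_int_cst; apply: le_Rintegral_itv.
- by move=> z; apply: cvg_norm; exact: cw.
- by move=> z; exact: cvg_cst.
- move=> z _; rewrite normrM -[M]mulr1 ler_pM//.
  by rewrite ler_norml cos_geN1 cos_le1.
Qed.

Lemma cosc_parts (R : realType) (v v1 v2 : R -> R) (k : nat) (x : R) :
  (forall y : R, is_derive y 1 v (v1 y)) ->
  (forall y : R, is_derive y 1 v1 (v2 y)) -> continuous v2 ->
  periodic1 v -> periodic1 v1 -> (0 < k)%N ->
  cosc v k x = - ((2 * pi * k%:R) ^- 2 * cosc v2 k x).
Proof.
move=> dv dv1 cv2 pv pv1 k0; have cv := is_derive_continuous dv.
have w0 : 2 * pi * k%:R != 0 :> R by rewrite !mulf_neq0 ?gt_eqF ?pi_gt0 ?ltr0n.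
rewrite /cosc; set w := 2 * pi * k%:R in w0 *.
(* Two integrations by parts at once: the derivative of [F] is the sum of both integrands, and [F]
   takes the same value at 0 and 1 by periodicity. *)
pose F z := w^-1 * (v (x + z) * sin (w * z)) + w ^- 2 * (v1 (x + z) * cos (w * z)).
have dF (z : R) : is_derive z 1 F
    (v (x + z) * cos (w * z) + w ^- 2 * (v2 (x + z) * cos (w * z))).
  have dsh (g g1 : R -> R) : (forall y : R, is_derive y 1 g (g1 y)) ->
      is_derive z 1 (fun z => g (x + z)) (g1 (x + z)).
    move=> dg; have := @is_derive_affine R g 1 x z _ (dg _).
    rewrite mulr1 mul1r addrC; apply: is_derive_ext => y; by rewrite mul1r addrC.
  have ds : is_derive z 1 (fun z => sin (w * z)) (cos (w * z) * w).
    have := @is_derive_affine R sin w 0 z _ (is_derive_sin _).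
    by rewrite addr0; apply: is_derive_ext => y; rewrite addr0.
  have dc : is_derive z 1 (fun z => cos (w * z)) (- sin (w * z) * w).
    have := @is_derive_affine R cos w 0 z _ (is_derive_cos _).
    by rewrite addr0; apply: is_derive_ext => y; rewrite addr0.
  have h1 := @is_deriveZ _ _ _ _ w^-1 _ _ _ (is_deriveM (dsh _ _ dv) ds).
  have h2 := @is_deriveZ _ _ _ _ (w ^- 2) _ _ _ (is_deriveM (dsh _ _ dv1) dc).
  apply: is_derive_eq (is_deriveD h1 h2) _.
  by rewrite /GRing.scale/=; field.
have c1 : continuous (fun z => v (x + z) * cos (w * z)).
  exact/continuous_mulcos/continuous_comp_addr.
have c2 : continuous (fun z => v2 (x + z) * cos (w * z)).
  exact/continuous_mulcos/continuous_comp_addr.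
have c3 : continuous (fun z => w ^- 2 * (v2 (x + z) * cos (w * z))).
  by move=> z; apply: cvgM; [exact: cvg_cst|exact: c2].
have c4 : continuous (fun z => v (x + z) * cos (w * z) +
    w ^- 2 * (v2 (x + z) * cos (w * z))).
  by move=> z; apply: cvgD; [exact: c1|exact: c3].
have := Rintegral_FTC (fun z _ => dF z) c4 ler01.
rewrite RintegralD_itv// RintegralZ_itv// /F.
have := @sin_2pik R k 0; have := @cos_2pik R k 0; rewrite -/w add0r => -> ->.
by rewrite addr0 pv pv1 subrr => /eqP; rewrite addr_eq0 => /eqP.
Qed.

(** The fourth power leaves room for a factor w^2 with a summable k^(-2) remaining: w^alpha in the
    terms of [Lambda], and the w^2 that bounds 1 - cos (w y). *)
Lemma cosc_decay (R : realType) (v : R -> R) : smooth v -> periodic1 v ->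
  exists2 M, 0 <= M & forall (k : nat) x, (0 < k)%N ->
    `|cosc v k x| <= M / (2 * pi * k%:R) ^+ 4.
Proof.
move=> sv pv.
have [M M0 vM] := periodic_bounded (@smooth_continuous _ _ 4 sv) (@periodic_derive1n _ _ 4 pv).
exists M => // k x k0.
have w0 : 0 < 2 * pi * k%:R :> R by rewrite !mulr_gt0 ?pi_gt0 ?ltr0n.
have d n := fun y : R => @smooth_is_derive _ _ n y sv.
have c n := @smooth_continuous _ _ n sv.
have p n := @periodic_derive1n _ _ n pv.
rewrite (cosc_parts x (d 0%N) (d 1%N) (c 2%N) (p 0%N) (p 1%N) k0).
rewrite (cosc_parts x (d 2%N) (d 3%N) (c 4%N) (p 2%N) (p 3%N) k0).
rewrite mulrN opprK mulrA normrM mulrC ler_pM//; first exact: cosc_le.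
by rewrite ger0_norm ?mulr_ge0 ?invr_ge0 ?exprn_ge0 ?(ltW w0)// -invfM -exprD.
Qed.

Lemma sum_inv_sqr_le (R : realType) (m n : nat) : (0 < m)%N ->
  \sum_(m.+1 <= k < n.+1) (k%:R ^- 2 : R) <= m%:R^-1.
Proof.
move=> m0; have [nm|mn] := ltnP n m.
  by rewrite big_geq ?invr_ge0 ?ler0n// ltnS ltnW.
suff : \sum_(m.+1 <= k < n.+1) (k%:R ^- 2 : R) <= m%:R^-1 - n%:R^-1.
  by move=> h; apply: le_trans h _; rewrite gerBl invr_ge0 ler0n.
rewrite -(subnKC mn); elim: (n - m)%N => [|d IH].
  by rewrite addn0 big_geq// subrr.
rewrite addnS big_nat_recr/=; last by rewrite ltnS leq_addr.
apply: le_trans (lerD IH (lexx _)) _.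
set N := (m + d)%N; have N0 : 0 < N%:R :> R by rewrite ltr0n /N addn_gt0 m0.
rewrite -natr1; set t : R := N%:R in N0 *.
have t1 : 0 < t + 1 by rewrite addr_gt0.
rewrite -subr_ge0; have -> : m%:R^-1 - (t + 1)^-1 - (m%:R^-1 - t^-1 + (t + 1) ^- 2)
  = (t * (t + 1) ^+ 2)^-1.
  by field; rewrite !gt_eqF// ?ltr0n// t1.
by rewrite invr_ge0 mulr_ge0 ?sqr_ge0 ?ltW.
Qed.

Lemma sum_tail_le (R : realType) (u : nat -> R) (B : R) (m n : nat) :
  0 <= B -> (forall k, (0 < k)%N -> `|u k| <= B / k%:R ^+ 2) -> (0 < m)%N ->
  `|\sum_(m.+1 <= k < n.+1) u k| <= B / m%:R.
Proof.
move=> B0 uB m0; apply: le_trans (ler_norm_sum _ _ _) _.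
apply: (@le_trans _ _ (\sum_(m.+1 <= k < n.+1) B * k%:R ^- 2)).
  rewrite big_nat_cond [leRHS]big_nat_cond; apply: ler_sum => k.
  by rewrite andbT => /andP[mk _]; apply: uB; rewrite (leq_trans _ mk).
by rewrite -mulr_sumr ler_wpM2l// sum_inv_sqr_le.
Qed.

Lemma cvg_sum_inv_sqr (R : realType) (u : nat -> R) (B : R) :
  0 <= B -> (forall k, (0 < k)%N -> `|u k| <= B / k%:R ^+ 2) ->
  cvg ((fun n => \sum_(1 <= k < n.+1) u k) @ \oo).
Proof.
move=> B0 uB.
have -> : (fun n => \sum_(1 <= k < n.+1) u k) = series (fun k => u k.+1).
  by apply/funext => n; rewrite seriesEnat big_add1.
apply: normed_cvg; apply: nondecreasing_is_cvgn.
  by apply/nondecreasing_series => k _ _; exact: normr_ge0.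
exists (B + B) => _ [n _ <-]; rewrite /= seriesEnat/=.
apply: (@le_trans _ _ (\sum_(0 <= k < n) B * k.+1%:R ^- 2)).
  by apply: ler_sum => k _; apply: uB.
rewrite -mulr_sumr -[leRHS]mulr2n -[leRHS]mulr_natr ler_wpM2l//.
case: n => [|n]; first by rewrite big_geq.
rewrite big_nat_recl// expr1n invr1 -[2%:R]/(1 + 1) lerD2l.
apply: le_trans (_ : \sum_(2 <= k < n.+2) (k%:R ^- 2 : R) <= _); last first.
  by rewrite (le_trans (@sum_inv_sqr_le R 1 n.+1 isT))// invr1.
by rewrite [leRHS]big_add1 [leRHS]big_add1/=.
Qed.

(** * Dirichlet kernel and pointwise convergence of Fourier series *)

Definition dirichlet (R : realType) (n : nat) (z : R) : R :=
  1 + \sum_(1 <= k < n.+1) 2 * cos (2 * pi * k%:R * z).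

(** With t = 2 pi z, the product of 1 - cos t and the n-th Dirichlet kernel is cos (n t) - cos ((n +
    1) t), so the sum over n telescopes to a quantity between 0 and 2, whatever N is. *)
Lemma fejer_identity (R : realType) (N : nat) (z : R) :
  (1 - cos (2 * pi * z)) * \sum_(0 <= n < N) dirichlet n z =
  1 - cos (2 * pi * N%:R * z).
Proof.
set t := 2 * pi * z.
have tE (n : nat) : 2 * pi * n%:R * z = n%:R * t by rewrite /t; ring.
have step n : (1 - cos t) * dirichlet n z = cos (n%:R * t) - cos (n.+1%:R * t).
  elim: n => [|n IH].
    by rewrite /dirichlet big_geq// addr0 mul0r cos0 mul1r mulr1.
  rewrite /dirichlet big_nat_recr//= addrA -/(dirichlet n z) mulrDr IH tE.
  have -> : n.+2%:R * t = n.+1%:R * t + t by rewrite -natr1; ring.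
  have -> : n%:R * t = n.+1%:R * t - t by rewrite -natr1; ring.
  by rewrite cosB cosD; ring.
rewrite tE; elim: N => [|N IH].
  by rewrite big_geq// mulr0 mul0r cos0 subrr.
by rewrite big_nat_recr//= mulrDr IH step subrKA.
Qed.

Lemma continuous_dirichlet (R : realType) (n : nat) : continuous (@dirichlet R n).
Proof.
move=> z; apply: cvgD; first exact: cvg_cst.
apply: continuous_bigsum => k y; apply: cvgM; first exact: cvg_cst.
exact: continuous_cosM.
Qed.

(** A crude form of Jordan's inequality: the mean value theorem gives the slope cos 1 on [0, 1], and
    beyond 1 the sine increases while x < 2, which costs the factor 1/2. *)
Lemma sin_ge_lin (R : realType) (x : R) : 0 <= x <= pi / 2 ->
  cos 1 / 2 * x <= sin x.
Proof.
move=> /andP[x0 xpi]; have xpi' : x <= pi by have := pi_gt0 R; lra.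
have c1 := @cos1_gt0 R; have pi2 := pi_ge2 R.
have small (y : R) : 0 <= y <= 1 -> cos 1 * y <= sin y.
  move=> /andP[y0 y1].
  have [c /andP[c0 cy] E] := MVT_is_derive (fun y => is_derive_sin y) y0.
  move: E; rewrite sin0 !subr0 => ->; rewrite ler_wpM2r// leNgt; apply/negP.
  by rewrite ltr_cos ?in_itv/=; [move=> h; lra|lra|lra].
have [x1|x1] := leP x 1.
  by apply: le_trans (small x _); rewrite ?x0// ler_wpM2r//; lra.
apply: (@le_trans _ _ (sin 1)).
  have := small 1; rewrite ler01 lexx mulr1 => /(_ isT); apply: le_trans.
  rewrite -[leRHS]mulr1 -mulrA ler_pM2l//.
  by have := @pihalf_lt2 R; lra.
by apply: ltW; rewrite ltr_sin ?in_itv/=; [|lra|lra].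
Qed.

Lemma oneBcos_ge (R : realType) (z : R) : 0 <= z <= 1 / 2 ->
  (cos 1) ^+ 2 * 2 * z ^+ 2 <= 1 - cos (2 * pi * z).
Proof.
move=> /andP[z0 z1]; have c1 := @cos1_gt0 R; have pi2 := pi_ge2 R.
rewrite oneBcos; have -> : 2 * pi * z / 2 = pi * z by field.
have z2 : 0 <= cos 1 * z by rewrite mulr_ge0// ltW.
have h : cos 1 * z <= sin (pi * z).
  have := @sin_ge_lin R (pi * z); rewrite mulr_ge0 ?pi_ge0//=.
  by move=> /(_ _)/(le_trans _); apply; nra.
by have := lerD (ler_pM z2 z2 h h) (ler_pM z2 z2 h h); nra.
Qed.

(* The partial sums converge by the decay of the coefficients; the limit is v x
   because the sums of s_n := S_n - v x over n < N stay bounded: they are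
   integrals of V, which is O(1 - cos (2 pi z)) by Taylor and symmetrisation,
   against the Fejer-type sum (1 - cos (2 pi N z)) / (1 - cos (2 pi z)). *)
Lemma cosc_series_cvg (R : realType) (v : R -> R) (x : R) :
  smooth v -> periodic1 v ->
  (fun n => cosc v 0 x + \sum_(1 <= k < n.+1) 2 * cosc v k x) @ \oo --> v x.
Proof.
move=> sv pv.
have cv : continuous v := @smooth_continuous _ _ 0 sv.
have [M M0 vM] := periodic_bounded (@smooth_continuous _ _ 2 sv) (@periodic_derive1n _ _ 2 pv).
pose S n := cosc v 0 x + \sum_(1 <= k < n.+1) 2 * cosc v k x.
have cvS : cvg (S @ \oo).
  apply: is_cvgD; first exact: is_cvg_cst.
  have [B B0 vB] := cosc_decay sv pv.
  apply: (@cvg_sum_inv_sqr _ _ (2 * B)) => [|k k0]; first by rewrite mulr_ge0.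
  rewrite normrM ger0_norm// -mulrA ler_wpM2l//.
  apply: le_trans (vB k x k0) _; rewrite ler_wpM2l// lef_pV2 ?posrE ?exprn_gt0 ?mulr_gt0 ?pi_gt0 ?ltr0n//.
  have k1 : 1 <= k%:R :> R by rewrite ler1n.
  have w1 : k%:R <= 2 * pi * k%:R :> R.
    by rewrite ler_peMl ?ler0n//; have := pi_ge2 R; lra.
  apply: (@le_trans _ _ (k%:R ^+ 4)); first by rewrite ler_weXn2l.
  by rewrite lerXn2r ?nnegrE ?ler0n ?mulr_ge0 ?pi_ge0 ?ler0n.
pose V z := (v (x + z) + v (x - z)) / 2 - v x.
have c1 := @continuous_comp_addr R v x cv; have c2 := @continuous_comp_subr R v x cv.
have cV : continuous V.
  apply: continuous_sub; last exact: continuous_const.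
  apply: continuous_mul; last exact: continuous_const.
  exact: continuous_add c1 c2.
(* Averaging v over x + z and x - z leaves the cosine coefficients unchanged, and subtracting the
   constant v x only affects the zeroth one. *)
have coscV k : circle_int (fun z => V z * cos (2 * pi * k%:R * z)) =
    cosc v k x - (if k == 0%N then v x else 0).
  set w := 2 * pi * k%:R.
  have -> : (fun z => V z * cos (w * z)) = (fun z => 2^-1 * (v (x + z) * cos (w * z)) +
       (2^-1 * (v (x - z) * cos (w * z)) + (-1) * (v x * cos (w * z)))).
    by apply/funext => z; rewrite /V; ring.
  have m1 := @continuous_mulcos R _ (w) c1; have m2 := @continuous_mulcos R _ (w) c2.
  have m3 := @continuous_mulcos R _ (w) (@continuous_const R (v x)).
  transitivity (2^-1 * circle_int (fun z => v (x + z) * cos (w * z)) +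
      (2^-1 * circle_int (fun z => v (x - z) * cos (w * z)) +
       -1 * circle_int (fun z => v x * cos (w * z)))).
    rewrite /circle_int RintegralD_itv; last 2 first.
    - exact: continuous_scale.
    - by apply: continuous_add; exact: continuous_scale.
    rewrite RintegralD_itv; [|exact: continuous_scale..].
    by rewrite (RintegralZ_itv _ _ _ m1) (RintegralZ_itv _ _ _ m2) (RintegralZ_itv _ _ _ m3).
  rewrite (cosc_refl k x cv pv).
  have E1 : circle_int (fun z => v x * cos (w * z)) = _ := cosc_cst (v x) k x.
  by rewrite E1 /cosc -/w; case: eqP => _; field.
have SE n : S n - v x = circle_int (fun z => V z * dirichlet n z).
  have -> : (fun z => V z * dirichlet n z) = (fun z => V z * cos (2 * pi * 0%:R * z) +
      \sum_(1 <= k < n.+1) 2 * (V z * cos (2 * pi * k%:R * z))).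
    apply/funext => z; rewrite mulr0 mul0r cos0 /dirichlet mulrDr; congr (_ + _).
    by rewrite mulr_sumr; apply: eq_bigr => k _; rewrite mulrCA.
  have m k := @continuous_mulcos R _ (2 * pi * k%:R) cV.
  have m' k := @continuous_scale R 2 _ (m k).
  rewrite /circle_int RintegralD_itv//; last exact: continuous_bigsum.
  rewrite Rintegral_sum_itv// -/(circle_int _) coscV/= /S addrAC; congr (_ + _).
  apply: eq_big_nat => k /andP[k0 _]; apply/esym.
  by rewrite (RintegralZ_itv _ _ _ (m k)) -/(circle_int _) coscV gtn_eqF// subr0.
have [C C0 VC] : exists2 C, 0 <= C & forall z, 0 <= z <= 1 -> `|V z| <= C * (1 - cos (2 * pi * z)).
  have cc := @cos1_gt0 R.
  have half z : 0 <= z <= 1 / 2 -> `|V z| <= M / (cos 1 ^+ 2 * 2) * (1 - cos (2 * pi * z)).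
    move=> /[dup] zh /andP[z0 _].
    have cc2 : 0 < cos 1 ^+ 2 * 2 :> R by rewrite mulr_gt0// exprn_gt0.
    apply: (@le_trans _ _ (M * z ^+ 2)); last first.
      by rewrite -mulrA ler_wpM2l// ler_pdivlMl// oneBcos_ge.
    have d0 (y : R) : is_derive y 1 v (derive1n 1 v y) := smooth_is_derive 0 y sv.
    have d1 (y : R) := @smooth_is_derive _ v 1 y sv.
    have dV (y : R) : is_derive y 1 V ((derive1n 1 v (x + y) - derive1n 1 v (x - y)) / 2).
      have h1 : is_derive y 1 (fun z => v (x + z)) (derive1n 1 v (x + y)).
        have := @is_derive_affine R v 1 x y _ (d0 _).
        by rewrite mulr1 mul1r addrC; apply: is_derive_ext => z'; rewrite mul1r addrC.
      have h2 : is_derive y 1 (fun z => v (x - z)) (- derive1n 1 v (x - y)).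
        have := @is_derive_affine R v (-1) x y _ (d0 _).
        by rewrite mulrN1 mulN1r addrC; apply: is_derive_ext => z'; rewrite mulN1r addrC.
      have h3 := is_deriveB (@is_deriveZ _ _ _ _ 2^-1 _ _ _ (is_deriveD h1 h2))
        (is_derive_cst (v x) y 1).
      apply: (@is_derive_ext R (fun z => 2^-1 * (v (x + z) + v (x - z)) - v x)).
        by move=> z'; rewrite /V mulrC.
      by apply: is_derive_eq h3 _; rewrite subr0 /GRing.scale/= mulrC.
    have [c /andP[c0 cz]] := MVT_is_derive dV z0.
    have -> : V 0 = 0 by rewrite /V subr0 addr0; field.
    rewrite !subr0 => ->; rewrite normrM expr2 mulrA (ger0_norm z0) ler_wpM2r//.
    have [|e _ ->] := MVT_is_derive d1 (_ : x - c <= x + c); first by lra.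
    have -> : x + c - (x - c) = 2 * c by ring.
    have -> : derive1n 2 v e * (2 * c) / 2 = derive1n 2 v e * c by field.
    by rewrite normrM (ger0_norm c0) ler_pM.
  exists (M / (cos 1 ^+ 2 * 2)).
    by rewrite divr_ge0// mulr_ge0// exprn_ge0// ltW.
  move=> z /andP[z0 z1]; have [zh|zh] := leP z (1 / 2); first by apply: half; rewrite z0.
  (* The weight 1 - cos (2 pi z) vanishes at z = 1 too; both sides are invariant under z -> 1 - z,
     which brings z back to the first half. *)
  have -> : V z = V (1 - z).
    have e1 : v (x + (1 - z)) = v (x - z) by rewrite -(pv (x - z)); congr v; ring.
    have e2 : v (x - (1 - z)) = v (x + z).
      by rewrite -(pv (x - (1 - z))); congr v; ring.
    by rewrite /V e1 e2 [v (x - z) + _]addrC.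
  have -> : cos (2 * pi * z) = cos (2 * pi * (1 - z)).
    have := @cos_2pik R 1 (- z); rewrite (_ : 2 * pi * 1%:R = 2 * pi) ?mulr1//.
    by rewrite mulrN cosN [- z + 1]addrC => ->.
  by apply: half; lra.
suff h : S n - v x @[n --> \oo] --> 0.
  have -> : (fun n => cosc v 0 x + \sum_(1 <= k < n.+1) 2 * cosc v k x) =
      (fun n => (S n - v x) + v x) by apply/funext => n; rewrite subrK.
  by rewrite -[X in _ --> X]add0r; apply: cvgD; [exact: h|exact: cvg_cst].
have bnd N : `|series (fun n => S n - v x) N| <= 2 * C.
  rewrite seriesEnat/=.
  have mD n : continuous (fun z => V z * dirichlet n z).
    by apply: continuous_mul => //; exact: continuous_dirichlet.
  have mS : continuous (fun z => \sum_(0 <= n < N) V z * dirichlet n z).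
    exact: continuous_bigsum.
  have -> : \sum_(0 <= n < N) (S n - v x) =
      circle_int (fun z => \sum_(0 <= n < N) V z * dirichlet n z).
    by rewrite /circle_int Rintegral_sum_itv//; apply: eq_bigr => n _; rewrite SE.
  apply: le_trans (le_normr_Rintegral _ (continuous_integrable_itv _ _ mS)) _ => //.
  rewrite -[leRHS]circle_int_cst; apply: le_Rintegral_itv.
  - by move=> z; apply: cvg_norm; exact: mS.
  - exact: continuous_const.
  move=> z z01; rewrite -mulr_sumr normrM.
  apply: le_trans (ler_wpM2r (normr_ge0 _) (VC z z01)) _.
  rewrite -[leLHS]mulrA [leRHS]mulrC ler_wpM2l//.
  rewrite -[X in X * _]ger0_norm ?oneBcos_ge0// -normrM fejer_identity.
  by rewrite ger0_norm ?oneBcos_ge0// oneBcos_le2.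
(* Bounded sums have Cesaro means tending to 0, and a convergent sequence shares the limit of its
   means. *)
have am0 : arithmetic_mean (fun n => S n - v x) @ \oo --> 0.
  apply/cvgrPdist_le => e e0; near=> n.
  rewrite sub0r normrN /arithmetic_mean/= normrM ger0_norm ?invr_ge0 ?ler0n//.
  rewrite ler_pdivrMl ?ltr0n// (le_trans (bnd _))// -ler_pdivrMr//.
  apply: (@le_trans _ _ n%:R); last by rewrite ler_nat.
  by near: n; exact: nbhs_infty_ger.
have cv1 : cvg ((fun n => S n - v x) @ \oo) by apply: is_cvgB => //; exact: is_cvg_cst.
have h1 := cesaro cv1.
by have E := cvg_unique _ h1 am0; rewrite -[X in _ --> X]E.
Unshelve. all: by end_near.
Qed.

(** * The fractional Laplacian at a maximum *)

(** The symmetric partial sum of [Lambda] with the modes k and -k paired. The mode 0 drops out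
    because 0 to the power alpha is 0 for alpha > 0. *)
Definition LambdaN (R : realType) (alpha : R) (v : R -> R) (x : R) (n : nat) : R :=
  \sum_(1 <= k < n.+1) 2 * (2 * pi * k%:R) `^ alpha * cosc v k x.

Lemma sum_symmetric (V : zmodType) (G : int -> V) (n : nat) :
  \sum_(j < n.*2.+1) G ((j : nat)%:Z - n%:Z) =
  G 0 + \sum_(1 <= k < n.+1) (G k%:Z + G (- k%:Z)).
Proof.
elim: n => [|n IH]; first by rewrite double0 big_ord1 [in RHS]big_geq// !addr0.
rewrite doubleS big_ord_recl big_ord_recr/=.
rewrite [in RHS]big_nat_recr//= [RHS]addrA -IH.
rewrite addrCA; congr (_ + _).
  apply: eq_bigr => i _; congr G; rewrite /bump/= add1n; lia.
rewrite addrC; congr (G _ + G _); last by rewrite sub0r.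
by rewrite /bump/= add1n; lia.
Qed.

Lemma circle_int_cosB (R : realType) (v : R -> R) (w x : R) : continuous v ->
  circle_int (fun z => v z * cos (w * z)) * cos (w * x) +
  circle_int (fun z => v z * sin (w * z)) * sin (w * x) =
  circle_int (fun z => v z * cos (w * (z - x))).
Proof.
move=> cv.
have c1 : continuous (fun z => v z * cos (w * z)) := continuous_mulcos cv.
have c2 : continuous (fun z => v z * sin (w * z)).
  apply: continuous_mul => // z; apply: (continuous_comp (f := fun y : R => w * y)).
    exact: mulrl_continuous.
  exact: continuous_sin.
have -> : (fun z => v z * cos (w * (z - x))) =
  (fun z => cos (w * x) * (v z * cos (w * z)) + sin (w * x) * (v z * sin (w * z))).
  by apply/funext => z; rewrite mulrBr cosB; ring.
rewrite /circle_int RintegralD_itv; [|exact: continuous_scale..].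
rewrite (RintegralZ_itv _ _ _ c1) (RintegralZ_itv _ _ _ c2).
by rewrite mulrC; congr (_ + _); rewrite mulrC.
Qed.

Lemma cosc_shift (R : realType) (v : R -> R) (k : nat) (x : R) :
  continuous v -> periodic1 v ->
  circle_int (fun z => v z * cos (2 * pi * k%:R * (z - x))) = cosc v k x.
Proof.
move=> cv pv; rewrite /cosc.
set w := fun z => v z * cos (2 * pi * k%:R * (z - x)).
rewrite -(@Rintegral_periodic_shift R w x).
- by congr circle_int; apply/funext => z; rewrite /w addrK addrC.
- have cs : continuous (fun z : R => z - x).
    by apply: continuous_sub; [move=> z; exact: cvg_id|exact: continuous_const].
  rewrite /w; apply: continuous_mul => // z.
  apply: (@continuous_comp R R R (fun z => z - x) (fun z => cos (2 * pi * k%:R * z))).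
    exact: cs.
  exact: continuous_cosM.
- by move=> z; rewrite /w pv addrAC cos_2pik.
Qed.

Lemma Lambda_partial_sumE (R : realType) (alpha : R) (v : R -> R) (x : R) (n : nat) :
  0 < alpha -> continuous v -> periodic1 v ->
  complex.Re (\sum_(j < n.*2.+1)
     let k : int := (j : nat)%:Z - n%:Z in
     real_complex R ((2 * pi * `|k%:~R : R|) `^ alpha)
     * fourier_coef v k * expi (2 * pi * k%:~R * x)) = LambdaN alpha v x n.
Proof.
move=> a0 cv pv.
pose G (k : int) : R := (2 * pi * `|k%:~R : R|) `^ alpha *
  circle_int (fun z => v z * cos (2 * pi * k%:~R * (z - x))).
rewrite raddf_sum/= (eq_bigr (fun j : 'I_n.*2.+1 => G ((j : nat)%:Z - n%:Z))); last first.
  move=> j _; set k := (j : nat)%:Z - n%:Z.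
  rewrite /G -circle_int_cosB//=; ring.
rewrite sum_symmetric {1}/G mulr0z normr0 mulr0 powR0 ?gt_eqF// mul0r add0r.
apply: eq_bigr => k _.
have -> : G (- k%:Z) = G k%:Z.
  rewrite /G mulrNz normrN; congr (_ * circle_int _); apply/funext => z.
  by rewrite mulrN mulNr cosN.
by rewrite /G -!pmulrn ger0_norm ?ler0n// cosc_shift//; ring.
Qed.

Lemma norm_LambdaN_term (R : realType) (alpha : R) (v : R -> R) :
  1 < alpha < 2 -> smooth v -> periodic1 v ->
  exists2 B, 0 <= B & forall (k : nat) x, (0 < k)%N ->
    `|2 * (2 * pi * k%:R) `^ alpha * cosc v k x| <= B / k%:R ^+ 2.
Proof.
move=> /andP[_ al2] sv pv; have [M M0 vM] := cosc_decay sv pv.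
exists (2 * M) => [|k x k0]; first by rewrite mulr_ge0.
have k1 : 1 <= k%:R :> R by rewrite ler1n.
have pi2 := pi_ge2 R.
have wk : k%:R <= 2 * pi * k%:R :> R by rewrite ler_peMl ?ler0n//; lra.
set w := 2 * pi * k%:R in wk *; have w0 : 0 < w by lra.
rewrite normrM ger0_norm ?mulr_ge0 ?powR_ge0//.
apply: le_trans (ler_wpM2l _ (vM k x k0)) _; first by rewrite mulr_ge0 ?powR_ge0.
rewrite -/w -!mulrA ler_wpM2l// mulrCA ler_wpM2l//.
apply: (@le_trans _ _ (w ^+ 2 / w ^+ 4)).
  rewrite ler_wpM2r ?invr_ge0 ?exprn_ge0 ?(ltW w0)// -powR_mulrn ?(ltW w0)//.
  by rewrite ler_powR ?(le_trans k1)// ltW.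
have -> : w ^+ 2 / w ^+ 4 = w ^- 2 by field; rewrite gt_eqF.
by rewrite lef_pV2 ?posrE ?exprn_gt0 ?(lt_le_trans ltr01 k1)// lerXn2r ?nnegrE ?ler0n// ltW.
Qed.

Lemma cvg_Lambda (R : realType) (alpha : R) (v : R -> R) (x : R) :
  1 < alpha < 2 -> smooth v -> periodic1 v ->
  LambdaN alpha v x @ \oo --> Lambda alpha v x.
Proof.
move=> al sv pv; have cv : continuous v := @smooth_continuous _ _ 0 sv.
have a0 : 0 < alpha by case/andP: al => h _; exact: lt_trans h.
have -> : Lambda alpha v x = lim (LambdaN alpha v x @ \oo).
  rewrite /Lambda; congr (lim (_ @ \oo)); apply/funext => n.
  exact: Lambda_partial_sumE.
have [B B0 vB] := norm_LambdaN_term al sv pv.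
exact: (cvg_sum_inv_sqr B0 (fun k k0 => vB k x k0)).
Qed.

Lemma cvg_bigsum (R : realType) (I : Type) (s : seq I) (f : I -> nat -> R)
    (l : I -> R) : (forall i, f i @ \oo --> l i) ->
  (fun n => \sum_(i <- s) f i n) @ \oo --> \sum_(i <- s) l i.
Proof.
move=> fl; elim: s => [|i s IH].
  rewrite big_nil; under eq_fun do rewrite big_nil; exact: cvg_cst.
rewrite big_cons; under eq_fun do rewrite big_cons.
by apply: cvgD; [exact: fl|exact: IH].
Qed.

Lemma min1sqr_bound (R : realType) (w y : R) : 2 <= w ->
  1 - cos (w * y) <= w ^+ 2 * min1sqr y.
Proof.
move=> w2; rewrite /min1sqr; case: (leP 1 (y ^+ 2)) => _.
  by apply: le_trans (oneBcos_le2 _) _; nra.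
by apply: le_trans (oneBcos_le _) _; rewrite exprMn; have := sqr_ge0 (w * y); rewrite exprMn; lra.
Qed.

(* kappa * Lambda g x is the integral over (0, +oo) of the second difference
   G of g at x against y^(-1-alpha); as G >= 0 at a maximum, it may be
   restricted to [r, 2r]. *)
Lemma Lambda_at_max (R : realType) (alpha : R) (g : R -> R) (x r : R) :
  1 < alpha < 2 -> smooth g -> periodic1 g -> (forall y, g y <= g x) -> 0 < r ->
  (2 * r) `^ (- (1 + alpha)) *
  \int[@lebesgue_measure R]_(y in `[r, 2 * r]) (g x - (g (x + y) + g (x - y)) / 2)
  <= kappa alpha * Lambda alpha g x.
Proof.
move=> al sg pg gmax r0; have cg : continuous g := @smooth_continuous _ _ 0 sg.
pose a k := cosc g k x.
pose G y := g x - (g (x + y) + g (x - y)) / 2.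
have G0 y : 0 <= G y by rewrite /G; have := gmax (x + y); have := gmax (x - y); lra.
have cG : continuous G.
  apply: continuous_sub; first exact: continuous_const.
  apply: continuous_mul; last exact: continuous_const.
  exact: continuous_add (continuous_comp_addr cg) (continuous_comp_subr cg).
(* Symmetrising in y turns the k-th mode of g at x + y and x - y into [a k] times cos (2 pi k y),
   and the mode 0 cancels; hence the sums [Gn] of these terms converge to [G]. *)
pose u y k := 2 * a k * (1 - cos (2 * pi * k%:R * y)).
pose Gn n y := \sum_(1 <= k < n.+1) u y k.
have cu k : continuous (u^~ k).
  apply: continuous_scale; apply: continuous_sub; first exact: continuous_const.
  exact: continuous_cosM.
have cGn n : continuous (Gn n) by exact: continuous_bigsum.
have [M M0 gM] := cosc_decay sg pg.
have uB y k : (0 < k)%N -> `|u y k| <= 2 * M * min1sqr y / k%:R ^+ 2.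
  move=> k0; have k1 : 1 <= k%:R :> R by rewrite ler1n.
  have pi2 := pi_ge2 R; have := gM k x k0; rewrite /u -/(a k).
  have wk : k%:R <= 2 * pi * k%:R :> R by rewrite ler_peMl ?ler0n//; lra.
  have w2 : 2 <= 2 * pi * k%:R :> R by nra.
  move: (2 * pi * k%:R) wk w2 => w wk w2 aM; have w0 : 0 < w by lra.
  rewrite normrM (ger0_norm (oneBcos_ge0 _)) normrM ger0_norm//.
  rewrite -!mulrA ler_wpM2l//.
  apply: le_trans (ler_pM _ _ aM (min1sqr_bound y w2)) _ => //.
  have -> : M / w ^+ 4 * (w ^+ 2 * min1sqr y) = M * (min1sqr y * w ^- 2).
    by field; rewrite gt_eqF.
  rewrite ler_wpM2l// ler_wpM2l ?min1sqr_ge0//.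
  by rewrite lef_pV2 ?posrE ?exprn_gt0 ?(lt_le_trans ltr01 k1)// lerXn2r ?nnegrE ?ler0n// ltW.
have cvgGn y : Gn ^~ y @ \oo --> G y.
  have cosy k : (cosc g k (x + y) + cosc g k (x - y)) / 2 =
      cosc g k x * cos (2 * pi * k%:R * y).
    pose w : R := 2 * pi * k%:R.
    have Ex z : cosc g k z = circle_int (fun t => g t * cos (w * t)) * cos (w * z) +
                circle_int (fun t => g t * sin (w * t)) * sin (w * z).
      by rewrite circle_int_cosB// cosc_shift.
    by rewrite !Ex -/w mulrDr mulrBr !cosD !sinD cosN sinN; field.
  have sumE n : (cosc g 0 x + \sum_(1 <= k < n.+1) 2 * cosc g k x) -
      ((cosc g 0 (x + y) + \sum_(1 <= k < n.+1) 2 * cosc g k (x + y)) +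
       (cosc g 0 (x - y) + \sum_(1 <= k < n.+1) 2 * cosc g k (x - y))) * 2^-1 = Gn n y.
    have c0 := cosy 0%N; rewrite mulr0 mul0r cos0 mulr1 in c0.
    rewrite addrACA mulrDl c0 opprD addrACA subrr add0r -big_split/= mulr_suml -sumrB.
    apply: eq_bigr => k _; rewrite /u -/(a k) -mulrDr -mulrA cosy -/(a k); ring.
  have e1 := @cosc_series_cvg _ _ x sg pg.
  have e2 := @cosc_series_cvg _ _ (x + y) sg pg.
  have e3 := @cosc_series_cvg _ _ (x - y) sg pg.
  have e4 := cvgB e1 (cvgM (cvgD e2 e3) (@cvg_cst R (2^-1 : R) nat \oo _)).
  move: e4; rewrite -/(G y); set F := (X in X @ _ --> _); suff -> : F = Gn ^~ y by apply.
  apply/funext => n; exact: sumE.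
(* The factor [min1sqr y] in the error is essential: a bound uniform in y would not be integrable
   against the kernel near 0. *)
have GGn n y : (0 < n)%N -> `|G y - Gn n y| <= 2 * M * min1sqr y / n%:R.
  move=> n0.
  have h : `|Gn m y - Gn n y| @[m --> \oo] --> `|G y - Gn n y|.
    apply: cvg_norm; apply: cvgB; [exact: cvgGn|exact: cvg_cst].
  apply: (cvgr_to_le h); near=> m.
  have nm : (n <= m)%N by near: m; exact: nbhs_infty_ge.
  rewrite /Gn (@big_cat_nat _ _ _ n.+1 1 m.+1)//= addrAC subrr add0r.
  apply: sum_tail_le => //; first by rewrite !mulr_ge0 ?min1sqr_ge0.
  by move=> k; exact: uB.
pose X := (2 * r) `^ (- (1 + alpha)) * \int[@lebesgue_measure R]_(y in `[r, 2 * r]) G y.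
pose Ca := (2 - alpha)^-1 + alpha^-1.
(* The number n of modes is fixed while the truncation [[1/(j+1), j+1]] is removed, so only finitely
   many limits to [kappa] are taken. The error is uniform in j, and n tends to infinity
   afterwards. *)
have main n : (0 < n)%N -> X - 2 * M / n%:R * Ca <= kappa alpha * LambdaN alpha g x n.
  move=> n0.
  pose I j := \sum_(1 <= k < n.+1) 2 * a k * ((2 * pi * k%:R) `^ alpha *
    Phi alpha (2 * pi * k%:R * j.+1%:R^-1) (2 * pi * k%:R * j.+1%:R)).
  have cvgI : I j @[j --> \oo] --> kappa alpha * LambdaN alpha g x n.
    rewrite /I /LambdaN big_add1/=; under eq_fun do rewrite big_add1/=.
    rewrite mulr_sumr; apply: cvg_bigsum => k.
    have w0 : 0 < 2 * pi * k.+1%:R :> R by rewrite !mulr_gt0 ?pi_gt0 ?ltr0n.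
    have -> : kappa alpha * (2 * (2 * pi * k.+1%:R) `^ alpha * cosc g k.+1 x) =
      2 * a k.+1 * ((2 * pi * k.+1%:R) `^ alpha * kappa alpha) by rewrite /a; ring.
    apply: cvgM; first exact: cvg_cst.
    by apply: cvgM; [exact: cvg_cst|exact: cvg_Phi].
  apply: (cvgr_to_ge cvgI); near=> j.
  have j1 : 1 <= j.+1%:R :> R by rewrite ler1n.
  have j0 : 0 < j.+1%:R^-1 :> R by rewrite invr_gt0 ltr0n.
  have jj : j.+1%:R^-1 <= j.+1%:R :> R by rewrite (le_trans _ j1)// invf_le1.
  have jr : j.+1%:R^-1 <= r.
    rewrite -[leRHS]invrK lef_pV2 ?posrE ?invr_gt0 ?ltr0n// (@le_trans _ _ j%:R) ?ler_nat//.
    by near: j; exact: nbhs_infty_ger.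
  have rj : 2 * r <= j.+1%:R.
    rewrite (@le_trans _ _ j%:R) ?ler_nat//.
    by near: j; exact: nbhs_infty_ger.
  set d := j.+1%:R^-1 in j0 jj jr *; set N := j.+1%:R in jj j1 rj *.
  have ck := @continuous_kern R alpha d j0.
  have cuk k : continuous (fun y => u y k * kern alpha d y) by apply: continuous_mul.
  have IE : I j = \int[@lebesgue_measure R]_(y in `[d, N]) (Gn n y * kern alpha d y).
    rewrite /Gn; under eq_Rintegral do rewrite mulr_suml.
    rewrite Rintegral_sum_itv// /I; apply: eq_big_nat => k /andP[k0 _].
    have w0 : 0 < 2 * pi * k%:R :> R by rewrite !mulr_gt0 ?pi_gt0 ?ltr0n.
    rewrite -(Rintegral_kern_scaling _ w0 j0 jj).
    rewrite -(RintegralZ_itv _ _ _ (continuous_cos_kern j0)).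
    by apply: eq_Rintegral => y _; rewrite /u mulrA.
  have cGk : continuous (fun y => G y * kern alpha d y) by apply: continuous_mul.
  have cmk : continuous (fun y => min1sqr y * kern alpha d y).
    by apply: continuous_mul => //; exact: continuous_min1sqr.
  have cGnk : continuous (fun y => Gn n y * kern alpha d y) by apply: continuous_mul.
  have h1 : \int[@lebesgue_measure R]_(y in `[d, N]) (G y * kern alpha d y) +
      - (2 * M / n%:R) * \int[@lebesgue_measure R]_(y in `[d, N]) (min1sqr y * kern alpha d y)
      <= I j.
    rewrite IE -(RintegralZ_itv _ _ _ cmk) -RintegralD_itv//; last exact: continuous_scale.
    apply: le_Rintegral_itv => //.
      by apply: continuous_add => //; exact: continuous_scale.
    move=> y _; rewrite mulrA -mulrDl ler_wpM2r ?kern_ge0//.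
    have := GGn n y n0; rewrite ler_norml => /andP[_ h].
    have -> : - (2 * M / n%:R) * min1sqr y = - (2 * M * min1sqr y / n%:R) by ring.
    by rewrite lerBlDl addrC -lerBlDl.
  have h2 := Rintegral_min1sqr_kern al j0 jj.
  have h3 : X <= \int[@lebesgue_measure R]_(y in `[d, N]) (G y * kern alpha d y).
    apply: (@le_trans _ _ (\int[@lebesgue_measure R]_(y in `[r, 2 * r]) (G y * kern alpha d y))); last first.
      apply: Rintegral_subset_itv => //; first by lra.
      by move=> y _; rewrite mulr_ge0 ?kern_ge0.
    rewrite /X -(RintegralZ_itv _ _ _ cG); apply: le_Rintegral_itv => //.
      exact: continuous_scale.
    move=> y /andP[ry yr]; rewrite mulrC ler_wpM2l// kernE ?(le_trans jr)//.
    rewrite !powRN lef_pV2 ?posrE ?powR_gt0 ?(lt_le_trans r0)//; last by lra.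
    case/andP: al => al1 _.
    by apply: ge0_ler_powR; rewrite ?nnegrE//; lra.
  apply: le_trans h1; apply: lerD => //.
  by rewrite -mulNr ler_wnM2l// oppr_le0 divr_ge0// mulr_ge0.
have h := @cvg_Lambda _ _ _ x al sg pg.
have h' : kappa alpha * LambdaN alpha g x n @[n --> \oo] --> kappa alpha * Lambda alpha g x.
  by apply: cvgM => //; exact: cvg_cst.
have h2 : X - 2 * M * Ca * n.+1%:R^-1 @[n --> \oo] --> X.
  rewrite -[X in _ --> X]subr0 -[X in _ - X](mulr0 (2 * M * Ca)).
  apply: cvgB; first exact: cvg_cst.
  by apply: cvgM; [exact: cvg_cst|exact: cvg_harmonic].
rewrite -(cvg_shiftS _ _) in h'.
rewrite -/X; apply: (ler_cvg_to h2 h'); near=> n.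
have := main n.+1 isT; apply: le_trans.
by have -> : 2 * M / n.+1%:R * Ca = 2 * M * Ca * n.+1%:R^-1 by ring.
Unshelve. all: by end_near.
Qed.

(** * Maximum principle for increments *)

Lemma smooth_slice (R : realType) (u : R -> R -> R) (t : R) :
  smooth_spacetime u -> 0 <= t -> smooth (u t).
Proof.
move=> su t0 n x.
have E m : iter_partial (nseq m false) u t = derive1n m (u t).
  by elim: m => [//|m IH]; rewrite derive1nS -IH.
by have [_ _ d] := su (nseq n false); rewrite -E; exact: d.
Qed.

(** Smoothness is only assumed for t >= 0; reflecting in time gives a function continuous on the
    whole plane that agrees with u at the times that matter. *)
Lemma continuous_spacetime (R : realType) (u : R -> R -> R) :
  smooth_spacetime u -> continuous (fun z : R * R => u `|z.1| z.2).
Proof.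
move=> su z; have [cu _ _] := su [::].
move/subspace_continuousP : cu => /(_ (`|z.1|, z.2) (normr_ge0 _)) h.
have cphi : (fun y : R * R => (`|y.1|, y.2)) @ z --> (`|z.1|, z.2).
  have c1 : (fun y : R * R => `|y.1|) @ z --> `|z.1| by apply: cvg_norm; exact: cvg_fst.
  have c2 : (fun y : R * R => y.2) @ z --> z.2 by exact: cvg_snd.
  exact: cvg_pair c1 c2.
move=> U UU; have h2 := cphi _ (h _ UU); rewrite /= in h2.
by apply: (@filterS _ (nbhs z) _ _ _ _ h2) => y /= Uy; exact: (Uy (normr_ge0 _)).
Qed.

Lemma smooth_increment (R : realType) (v : R -> R) (s h : R) :
  smooth v -> smooth (fun y => s * (v (y + h) - v y)).
Proof.
move=> sv.
apply: (@smooth_chain _ _ (fun n y => s * (derive1n n v (y + h) - derive1n n v y))) => // n x.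
have d1 : is_derive x 1 (fun y => derive1n n v (y + h)) (derive1n n.+1 v (x + h)).
  have := @is_derive_affine R (derive1n n v) 1 h x _ (smooth_is_derive n _ sv).
  by rewrite mulr1 mul1r; apply: is_derive_ext => z; rewrite mul1r.
exact: (@is_deriveZ _ _ _ _ s _ _ _ (is_deriveB d1 (smooth_is_derive n x sv))).
Qed.

Lemma periodic_increment (R : realType) (v : R -> R) (s h : R) :
  periodic1 v -> periodic1 (fun y => s * (v (y + h) - v y)).
Proof. by move=> pv y; rewrite addrAC !pv. Qed.

Lemma cosc_increment (R : realType) (v : R -> R) (s h : R) (k : nat) (x : R) :
  continuous v -> cosc (fun y => s * (v (y + h) - v y)) k x =
  s * (cosc v k (x + h) - cosc v k x).
Proof.
move=> cv; rewrite /cosc /circle_int; set w := 2 * pi * k%:R.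
have c1 := continuous_mulcos (a := w) (@continuous_comp_addr _ _ (x + h) cv).
have c2 := continuous_mulcos (a := w) (@continuous_comp_addr _ _ x cv).
rewrite -[- (\int[_]_(_ in _) _)]mulN1r -(RintegralZ_itv _ _ _ c2) -RintegralD_itv//; last first.
  exact: continuous_scale.
rewrite -RintegralZ_itv; last by apply: continuous_add => //; exact: continuous_scale.
by apply: eq_Rintegral => z _; rewrite (addrAC x h z); ring.
Qed.

Lemma Lambda_increment (R : realType) (alpha : R) (v : R -> R) (s h x : R) :
  1 < alpha < 2 -> smooth v -> periodic1 v ->
  Lambda alpha (fun y => s * (v (y + h) - v y)) x =
  s * (Lambda alpha v (x + h) - Lambda alpha v x).
Proof.
move=> al sv pv; have cv : continuous v := @smooth_continuous _ _ 0 sv.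
have h1 := @cvg_Lambda _ _ _ x al (@smooth_increment _ _ s h sv) (@periodic_increment _ _ s h pv).
have h2 := @cvg_Lambda _ _ _ x al sv pv.
have h3 := @cvg_Lambda _ _ _ (x + h) al sv pv.
have h4 : s * (LambdaN alpha v (x + h) n - LambdaN alpha v x n) @[n --> \oo] -->
    s * (Lambda alpha v (x + h) - Lambda alpha v x).
  by apply: cvgM; [exact: cvg_cst|exact: cvgB].
have E : LambdaN alpha (fun y => s * (v (y + h) - v y)) x =
    (fun n => s * (LambdaN alpha v (x + h) n - LambdaN alpha v x n)).
  apply/funext => n; rewrite /LambdaN -sumrB mulr_sumr; apply: eq_bigr => k _.
  by rewrite cosc_increment//; ring.
by rewrite E in h1; exact: cvg_unique h1 h4.
Qed.

Lemma periodic_reduce_from (R : realType) (a x : R) :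
  exists k : int, a <= x + k%:~R <= a + 1.
Proof.
have [k /andP[k0 k1]] := periodic_reduce (x - a).
by exists k; apply/andP; split; lra.
Qed.

Lemma is_derive_at_max (R : realType) (F f : R -> R) (a b c : R) :
  (forall x : R, is_derive x 1 F (f x)) -> a < c < b ->
  (forall x, a < x < b -> F x <= F c) -> f c = 0.
Proof.
move=> dF /[dup] acb /andP[ac cb] Fc; have ab : a <= b by rewrite ltW// (lt_trans ac).
have cI : c \in `]a, b[%R by rewrite in_itv.
have [||_ E] := @derive1_at_max R F a b c ab _ cI _.
- by move=> x _; have [h _] := dF x.
- by move=> x; rewrite in_itv; exact: Fc.
- by have [_ <-] := dF c.
Qed.

(* At a positive maximum of s (u t (x+h) - u t x) - L h - e t the first order
   conditions in x and h give both slopes s L, so that only the sign of the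
   time derivative remains to be checked. *)
Lemma increment_comparison (R : realType) (u : R -> R -> R) (s L : R) :
  smooth_spacetime u -> (forall t, 0 <= t -> periodic1 (u t)) ->
  s ^+ 2 = 1 -> 0 < L ->
  (forall x h, 0 <= h <= 1 -> s * (u 0 (x + h) - u 0 x) <= L * h) ->
  (forall t x h, 0 < t -> 0 < h < 1 ->
     (forall y, s * (u t (y + h) - u t y) <= s * (u t (x + h) - u t x)) ->
     L * h < s * (u t (x + h) - u t x) ->
     derive1 (u t) x = s * L -> derive1 (u t) (x + h) = s * L ->
     s * (dt u t (x + h) - dt u t x) <= 0) ->
  forall t x h, 0 <= t -> 0 <= h <= 1 -> s * (u t (x + h) - u t x) <= L * h.
Proof.
move=> su pu s2 L0 init key t1 x1 h1 t10 h101; rewrite leNgt; apply/negP => bad.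
pose del := s * (u t1 (x1 + h1) - u t1 x1) - L * h1.
have del0 : 0 < del by rewrite subr_gt0.
(* The penalty e t forces the time derivative at the maximum to be at least e > 0. Since e t1 < del,
   the penalised maximum stays positive; t1 + 1 in the denominator covers t1 = 0. *)
pose e := del / (2 * (t1 + 1)).
have e0 : 0 < e by rewrite divr_gt0// mulr_gt0//; lra.
have et1 : e * t1 < del.
  by rewrite /e mulrAC ltr_pdivrMr; nra.
pose F (p : R * R * R) := s * (u `|p.1.1| (p.1.2 + p.2) - u `|p.1.1| p.1.2)
   - L * p.2 - e * p.1.1.
pose A : set (R * R * R) := (`[0, t1] `*` `[x1, x1 + 1]) `*` `[0, 1].
have cA : compact A.
  by apply: compact_setX; [apply: compact_setX|]; exact: segment_compact.
have cU := continuous_spacetime su.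
have cF : continuous F.
  move=> p.
  have p11 : (fun q : R * R * R => q.1.1) @ p --> p.1.1.
    by apply: (@cvg_comp _ _ _ fst fst); [exact: cvg_fst|exact: cvg_fst].
  have p12 : (fun q : R * R * R => q.1.2) @ p --> p.1.2.
    by apply: (@cvg_comp _ _ _ fst snd); [exact: cvg_fst|exact: cvg_snd].
  have p2 : (fun q : R * R * R => q.2) @ p --> p.2 by exact: cvg_snd.
  have U1 : (fun q : R * R * R => u `|q.1.1| (q.1.2 + q.2)) @ p --> u `|p.1.1| (p.1.2 + p.2).
    apply: (@cvg_comp _ _ _ (fun q : R * R * R => (q.1.1, q.1.2 + q.2)) (fun z : R * R => u `|z.1| z.2) _ _ _ _ (cU (p.1.1, p.1.2 + p.2))).
    exact: cvg_pair p11 (cvgD p12 p2).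
  have U2 : (fun q : R * R * R => u `|q.1.1| q.1.2) @ p --> u `|p.1.1| p.1.2.
    apply: (@cvg_comp _ _ _ (fun q : R * R * R => (q.1.1, q.1.2)) (fun z : R * R => u `|z.1| z.2) _ _ _ _ (cU (p.1.1, p.1.2))).
    exact: cvg_pair p11 p12.
  apply: cvgB; last by apply: cvgM; [exact: cvg_cst|exact: p11].
  apply: cvgB; last by apply: cvgM; [exact: cvg_cst|exact: p2].
  by apply: cvgM; [exact: cvg_cst|exact: cvgB].
have A1 : A ((t1, x1), h1) by split => /=; [split|]; rewrite /= in_itv/= ?lexx ?t10//= lerDl.
have [[[t0 x0] h0]] := compact_EVT_max (ex_intro _ _ A1) cA (continuous_subspaceT cF).
rewrite inE => -[[]] /=; rewrite !in_itv/= => /andP[t00 t01] /andP[x0l x0r] /andP[h00 h01] Fmax.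
have F0 : 0 < F ((t0, x0), h0).
  apply: lt_le_trans (Fmax _ (mem_set A1)).
  by rewrite /F/= (ger0_norm t10) -/del; lra.
have FE t x h : 0 <= t -> F ((t, x), h) = s * (u t (x + h) - u t x) - L * h - e * t.
  by move=> t_; rewrite /F/= ger0_norm.
rewrite FE// in F0.
(* Positivity of the maximum excludes the boundary faces: t = 0 by the initial bound, h = 0 because
   the increment vanishes, h = 1 because it vanishes by periodicity. *)
have tpos : 0 < t0.
  rewrite lt_neqAle t00 andbT eq_sym; apply/eqP => t00'.
  by have := init x0 h0; rewrite h00 h01 => /(_ isT); move: F0; rewrite t00'; lra.
have et0 : 0 < e * t0 by rewrite mulr_gt0.
have hpos : 0 < h0.
  rewrite lt_neqAle h00 andbT; apply/eqP => h0'.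
  by move: F0; rewrite -h0' addr0 subrr !mulr0; lra.
have hlt : h0 < 1.
  rewrite lt_neqAle h01 andbT; apply/eqP => h0'.
  by move: F0; rewrite h0' (pu _ t00) subrr mulr0; lra.
have gmax y : s * (u t0 (y + h0) - u t0 y) <= s * (u t0 (x0 + h0) - u t0 x0).
  have [k kx] := periodic_reduce_from x1 y.
  have Ay : A ((t0, y + k%:~R), h0).
    by split=> /=; [split|]; rewrite /= in_itv/= ?t00 ?t01 ?h00 ?h01.
  have := Fmax _ (mem_set Ay); rewrite !FE// (addrAC y) !(periodicZ _ _ (pu _ t00)); lra.
have big : L * h0 < s * (u t0 (x0 + h0) - u t0 x0) by lra.
have du (y : R) : is_derive y 1 (u t0) (derive1 (u t0) y).
  exact: (smooth_is_derive 0 y (smooth_slice su t00)).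
have dux h (y : R) : is_derive y 1 (fun y => u t0 (y + h)) (derive1 (u t0) (y + h)).
  have := @is_derive_affine R (u t0) 1 h y _ (du _).
  by rewrite mulr1 mul1r; apply: is_derive_ext => z; rewrite mul1r.
have dhx (y : R) : is_derive y 1 (fun y => u t0 (x0 + y)) (derive1 (u t0) (x0 + y)).
  by have := dux x0 y; rewrite addrC; apply: is_derive_ext => z; rewrite addrC.
have ux : s * (derive1 (u t0) (x0 + h0) - derive1 (u t0) x0) = 0.
  have d1 (y : R) := @is_deriveZ _ _ _ _ s _ _ _ (is_deriveB (dux h0 y) (du y)).
  apply: (is_derive_at_max (a := x0 - 1) (b := x0 + 1) d1); first by lra.
  by move=> y _; exact: gmax.
have uh : s * derive1 (u t0) (x0 + h0) = L.
  have d1 (y : R) : is_derive y 1 (fun y => s * (u t0 (x0 + y) - u t0 x0) - L * y)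
      (s * derive1 (u t0) (x0 + y) - L).
    have d2 := is_deriveB (@is_deriveZ _ _ _ _ s _ _ _
      (is_deriveB (dhx y) (is_derive_cst (u t0 x0) y 1)))
      (@is_deriveZ _ _ _ _ L _ _ _ (is_derive_id y 1)).
    by apply: is_derive_eq d2 _; rewrite subr0 /GRing.scale/= mulr1.
  apply/eqP; rewrite -subr_eq0; apply/eqP.
  apply: (is_derive_at_max (a := 0) (b := 1) d1); first by rewrite hpos.
  move=> y /andP[y0 y1].
  have Ay : A ((t0, x0), y).
    by split=> /=; [split|]; rewrite /= in_itv/= ?t00 ?t01 ?x0l ?x0r ?(ltW y0) ?(ltW y1).
  by have := Fmax _ (mem_set Ay); rewrite !FE//; lra.
have uxh : derive1 (u t0) (x0 + h0) = s * L by rewrite -uh mulrA -expr2 s2 mul1r.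
have ux0 : derive1 (u t0) x0 = s * L.
  rewrite -uxh; have : s * (s * (derive1 (u t0) (x0 + h0) - derive1 (u t0) x0)) = 0 by rewrite ux mulr0.
  by rewrite mulrA -expr2 s2 mul1r => /eqP; rewrite subr_eq0 => /eqP.
have hh : 0 < h0 < 1 by rewrite hpos.
have := key t0 x0 h0 tpos hh gmax big ux0 uxh.
rewrite leNgt => /negP; apply; apply: (@lt_le_trans _ _ e) => //.
have [_ cdt _] := su [::].
have tnear : nbhs (0 : R) [set y | 0 < t0 + y].
  have h : (fun y => t0 + y) @ (0 : R) --> t0.
    by rewrite -[X in _ --> X]addr0; apply: cvgD; [exact: cvg_cst|exact: cvg_id].
  exact: cvgr_gt h _ tpos.
have tleft : (0 : R)^'- [set y | 0 < t0 + y].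
  suff : nbhs (0 : R) [set y | y < 0 -> 0 < t0 + y] by [].
  by apply: (filterS _ tnear) => y yt _; exact: yt.
(* The maximum may sit at the final time, so only left difference quotients can be compared. As t0 >
   0, [dt_filter] contains those with small increments. *)
have left0 (P : set R) : dt_filter t0 P -> (0 : R)^'- P.
  move=> h; have h' : nbhs (0 : R) [set y | y != 0 -> 0 <= t0 + y -> P y] := h.
  suff : nbhs (0 : R) [set y | y < 0 -> P y] by [].
  apply: (filterS _ (filterI h' tnear)) => y [/= Py ty] y0.
  by apply: Py; [rewrite lt_eqF|exact: ltW].
have cq y : dt_quot u t0 y @ (0 : R)^'- --> dt u t0 y.
  have h := cdt t0 y t00; apply: cvg_trans h => P; exact: left0.
have cq2 : (fun y => s * (dt_quot u t0 (x0 + h0) y - dt_quot u t0 x0 y)) @ (0 : R)^'- -->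
    s * (dt u t0 (x0 + h0) - dt u t0 x0).
  by apply: cvgM; [exact: cvg_cst|apply: cvgB; exact: cq].
apply: (cvgr_to_ge cq2); near=> y.
have y0 : y < 0 by [].
have ty : 0 <= t0 + y by apply: ltW; near: y; exact: tleft.
have Ay : A ((t0 + y, x0), h0).
  split=> /=; [split|]; rewrite /= in_itv/= ?ty ?x0l ?x0r ?h00 ?h01//=.
  by apply: le_trans t01; rewrite gerDl ltW.
have := Fmax _ (mem_set Ay); rewrite !FE// /dt_quot => h.
have -> : s * (y^-1 * (u (t0 + y) (x0 + h0) - u t0 (x0 + h0)) -
   y^-1 * (u (t0 + y) x0 - u t0 x0)) =
  (s * (u (t0 + y) (x0 + h0) - u (t0 + y) x0) - s * (u t0 (x0 + h0) - u t0 x0)) / y.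
  by field; rewrite lt_eqF.
by rewrite ler_ndivlMr//; lra.
Unshelve. all: by end_near.
Qed.

(** * Slope bounds for solutions of the equation *)

Lemma dt_burgers (R : realType) (alpha : R) (f : R -> R) (nu : R) (u0 : R -> R)
    (u : R -> R -> R) (t x : R) :
  smooth f -> burgers_solution alpha f nu u0 u -> 0 <= t ->
  dt u t x = - (derive1n 1 f (u t x) * derive1 (u t) x) - nu * Lambda alpha (u t) x.
Proof.
move=> sf [_ su _ pde _] t0; have := pde t x t0.
have d1 := smooth_is_derive 0 (u t x) sf.
have d2 := smooth_is_derive 0 x (smooth_slice su t0).
have [_ E] := is_derive1_comp d1 d2.
rewrite {1}/dx derive1E; rewrite /comp in E; rewrite E.
by rewrite -addrA => /eqP; rewrite addr_eq0 => /eqP ->; rewrite opprD.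
Qed.

(** With equal slopes at both points, the transport terms only differ through f', whose variation is
    controlled by f''. *)
Lemma increment_dt (R : realType) (alpha : R) (f : R -> R) (nu : R) (u0 : R -> R)
    (u : R -> R -> R) (s L t x h : R) :
  1 < alpha < 2 -> smooth f -> burgers_solution alpha f nu u0 u -> 0 <= t ->
  s ^+ 2 = 1 ->
  derive1 (u t) x = s * L -> derive1 (u t) (x + h) = s * L ->
  s * (dt u t (x + h) - dt u t x) =
  L * (derive1n 1 f (u t x) - derive1n 1 f (u t (x + h))) -
  nu * Lambda alpha (fun y => s * (u t (y + h) - u t y)) x.
Proof.
move=> al sf sol t0 s2 dx1 dx2.
rewrite !(dt_burgers _ sf sol t0) dx1 dx2; case: sol => pu su _ _ _.
rewrite (Lambda_increment _ _ _ al (smooth_slice su t0) (pu t t0)).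
set a := derive1n 1 f _; set b := derive1n 1 f _.
transitivity (s ^+ 2 * (L * (b - a)) - nu * (s * (Lambda alpha (u t) (x + h) - Lambda alpha (u t) x))).
  by ring.
by rewrite s2 mul1r.
Qed.

Lemma derive1_increment_ge (R : realType) (f : R -> R) (sigma a b : R) :
  smooth f -> (forall x, sigma <= derive1n 2 f x) -> a <= b ->
  sigma * (b - a) <= derive1n 1 f b - derive1n 1 f a.
Proof.
move=> sf f2 ab; have [c _ ->] := MVT_is_derive (fun x => smooth_is_derive 1 x sf) ab.
by rewrite ler_wpM2r// subr_ge0.
Qed.

Lemma Lambda_max_ge0 (R : realType) (alpha : R) (g : R -> R) (x : R) :
  1 < alpha < 2 -> smooth g -> periodic1 g -> (forall y, g y <= g x) ->
  0 <= Lambda alpha g x.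
Proof.
move=> al sg pg gmax; have := Lambda_at_max al sg pg gmax ltr01.
rewrite -(pmulr_rge0 _ (kappa_gt0 al)); apply: le_trans.
rewrite mulr_ge0 ?powR_ge0//; apply: Rintegral_ge0_itv => y _.
by have := gmax (x + y); have := gmax (x - y); lra.
Qed.

(** Oleinik's one-sided bound in the form needed here: the slope bound of the initial data is
    preserved, with no decay in time. *)
Lemma oleinik (R : realType) (alpha : R) (f : R -> R) (sigma nu D : R)
    (u0 : R -> R) (u : R -> R -> R) :
  1 < alpha < 2 -> smooth f -> 0 < sigma -> (forall x, sigma <= derive1n 2 f x) ->
  0 < nu -> 0 < D -> smooth u0 -> (forall x, derive1 u0 x <= D) ->
  burgers_solution alpha f nu u0 u ->
  forall t x h, 0 <= t -> 0 <= h <= 1 -> u t (x + h) - u t x <= D * h.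
Proof.
move=> al sf sig0 f2 nu0 D0 su0 u0D sol t x h t0 h01.
have [pu su _ _ ui] := sol.
rewrite -[leLHS]mul1r; apply: increment_comparison => //; first by rewrite expr1n.
  move=> {h01} {}x {}h /andP[h0 _]; rewrite mul1r ui.
  have [|c _ ->] := MVT_is_derive (fun x => smooth_is_derive 0 x su0) (_ : x <= x + h).
    by rewrite lerDl.
  by rewrite addrC addKr ler_wpM2r//; exact: u0D.
move=> {h01 t0} {}t {}x {}h t0 /andP[h0 h1] gmax big dx1 dx2.
rewrite (increment_dt al sf sol (ltW t0) (expr1n _ _) dx1 dx2).
have st := smooth_slice su (ltW t0).
have := Lambda_max_ge0 al (@smooth_increment _ _ 1 h st) (@periodic_increment _ _ 1 h (pu t (ltW t0))) gmax.
move=> L0; have uu : u t x <= u t (x + h) by have := mulr_gt0 D0 h0; lra.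
have := derive1_increment_ge sf f2 uu => m.
have m0 : 0 <= sigma * (u t (x + h) - u t x) by rewrite mulr_ge0 ?(ltW sig0)// subr_ge0.
rewrite subr_le0; apply: (@le_trans _ _ 0); last by rewrite mulr_ge0// ltW.
by rewrite pmulr_rle0//; lra.
Qed.

(** A bound on rises to the right suffices: a translate of x by an integer lies in [y, y + 1]. *)
Lemma periodic_osc_le (R : realType) (v : R -> R) (D : R) :
  continuous v -> periodic1 v ->
  (forall x h, 0 <= h <= 1 -> v (x + h) - v x <= D * h) -> 0 <= D ->
  forall x y, v x - v y <= D.
Proof.
move=> cv pv vD D0 x y; have [k /andP[k0 k1]] := periodic_reduce_from y x.
have hh : 0 <= x + k%:~R - y <= 1 by apply/andP; split; lra.
have := vD y _ hh; rewrite [y + _]addrC subrK (periodicZ _ _ pv) => h.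
by apply: le_trans h _; rewrite ler_piMr//; lra.
Qed.

(** With zero mean, v x is the average of v x - v y over y. *)
Lemma zero_mean_sup_le (R : realType) (v : R -> R) (D : R) :
  continuous v -> circle_int v = 0 -> (forall x y, v x - v y <= D) ->
  forall x, `|v x| <= D.
Proof.
move=> cv v0 vD x.
have c1 : continuous (fun y => v x - v y).
  by apply: continuous_sub => //; exact: continuous_const.
have i1 : circle_int (fun y => v x - v y) = v x.
  rewrite -[RHS]subr0 -[X in _ - X]v0 -{2}(circle_int_cst (v x)) -mulN1r /circle_int.
  rewrite -(RintegralZ_itv _ _ _ cv) -RintegralD_itv//; last 2 first.
  - exact: continuous_const.
  - exact: continuous_scale.
  by apply: eq_Rintegral => y _; rewrite mulN1r.
rewrite -i1 -[D]circle_int_cst ler_norml -[- circle_int _]mulN1r.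
rewrite /circle_int -(RintegralZ_itv _ _ _ (@continuous_const R D)).
apply/andP; split; apply: le_Rintegral_itv => //; try exact: continuous_const.
- by move=> y _; have := vD y x; lra.
Qed.

(** The integral of an increment is a difference of two increments of a primitive of v, each at most
    D h in absolute value. The bound thus keeps the factor h and does not grow with r. *)
Lemma Rintegral_increment_le (R : realType) (v : R -> R) (D x h r : R) :
  continuous v -> (forall y, `|v y| <= D) -> 0 <= h -> 0 <= r ->
  \int[@lebesgue_measure R]_(y in `[r, 2 * r]) (v (x + y) - v (x + y + h)) <= 2 * D * h /\
  \int[@lebesgue_measure R]_(y in `[r, 2 * r]) (v (x - y) - v (x - y + h)) <= 2 * D * h.
Proof.
move=> cv vD h0 r0; have [W dW] := continuous_antiderivative cv.
have W_le a : `|W (a + h) - W a| <= D * h.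
  have [|c _ ->] := MVT_is_derive dW (_ : a <= a + h); first by rewrite lerDl.
  by rewrite addrC addKr normrM (ger0_norm h0) ler_wpM2r.
have r2 : r <= 2 * r by lra.
have dWa a (y : R) : is_derive y 1 (fun y => W (a + y)) (v (a + y)).
  have := @is_derive_affine R W 1 a y _ (dW _).
  by rewrite mulr1 mul1r addrC; apply: is_derive_ext => z; rewrite mul1r addrC.
have dWs a (y : R) : is_derive y 1 (fun y => W (a - y)) (- v (a - y)).
  have := @is_derive_affine R W (-1) a y _ (dW _).
  by rewrite mulrN1 mulN1r addrC; apply: is_derive_ext => z; rewrite mulN1r addrC.
have d1 (y : R) : is_derive y 1 (fun y => W (x + y) - W (x + y + h)) (v (x + y) - v (x + y + h)).
  apply: is_deriveB => //.
  by rewrite addrAC; apply: is_derive_ext (dWa (x + h) y) => z; rewrite addrAC.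
have d2 (y : R) : is_derive y 1 (fun y => - W (x - y) + W (x - y + h)) (v (x - y) - v (x - y + h)).
  have e2 : is_derive y 1 (fun y => W (x - y + h)) (- v (x - y + h)).
    by rewrite addrAC; apply: is_derive_ext (dWs (x + h) y) => z; rewrite addrAC.
  by apply: is_derive_eq (is_deriveD (is_deriveN (dWs x y)) e2) _; rewrite opprK.
have c1 : continuous (fun y => v (x + y) - v (x + y + h)).
  apply: continuous_sub; first exact: continuous_comp_addr.
  by under eq_fun do rewrite addrAC; exact: continuous_comp_addr.
have c2 : continuous (fun y => v (x - y) - v (x - y + h)).
  apply: continuous_sub; first exact: continuous_comp_subr.
  by under eq_fun do rewrite addrAC; exact: continuous_comp_subr.
rewrite (Rintegral_FTC (fun y _ => d1 y) c1 r2) (Rintegral_FTC (fun y _ => d2 y) c2 r2).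
have := W_le (x + r); have := W_le (x + 2 * r).
have := W_le (x - r); have := W_le (x - 2 * r).
rewrite !ler_norml => /andP[? ?] /andP[? ?] /andP[? ?] /andP[? ?].
by split; lra.
Qed.

(* g is an increment of u, so its integrals are at most of order D h, whereas
   g x > L h: with r = 4 D / L the maximum of g dominates the averages at
   distance r and Lambda g x is at least of order g x * r^(-alpha). For large L
   this beats the quadratic term L C2 g x. *)
Lemma lower_slope (R : realType) (alpha : R) (f : R -> R) (nu D C2 L : R)
    (u0 : R -> R) (u : R -> R -> R) :
  1 < alpha < 2 -> smooth f -> 0 <= C2 ->
  (forall x, `|x| <= D -> derive1n 2 f x <= C2) ->
  0 < nu -> 0 < D -> smooth u0 -> (forall x, - L <= derive1 u0 x) ->
  burgers_solution alpha f nu u0 u ->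
  (forall t x, 0 <= t -> `|u t x| <= D) -> 0 < L ->
  kappa alpha * (L * C2) <= nu * ((8 * D / L) `^ (- alpha) / 4) ->
  forall t x h, 0 <= t -> 0 <= h <= 1 -> u t x - u t (x + h) <= L * h.
Proof.
move=> al sf C20 f2 nu0 D0 su0 u0L sol uD L0 Lbig t x h t0 h01.
have [pu su _ _ ui] := sol.
have -> : u t x - u t (x + h) = -1 * (u t (x + h) - u t x) by ring.
have m1 : (-1) ^+ 2 = 1 :> R by rewrite sqrrN expr1n.
apply: increment_comparison => //.
  move=> {h01} {}x {}h /andP[h0 _]; rewrite mulN1r ui.
  have [|c _ ->] := MVT_is_derive (fun x => smooth_is_derive 0 x su0) (_ : x <= x + h).
    by rewrite lerDl.
  by rewrite addrC addKr -mulNr ler_wpM2r// lerNl; exact: u0L.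
move=> {h01 t0} {}t {}x {}h t0 /andP[h0 h1] gmax big dx1 dx2.
rewrite (increment_dt al sf sol (ltW t0) m1 dx1 dx2).
have st := smooth_slice su (ltW t0).
have ct : continuous (u t) := @smooth_continuous _ _ 0 st.
pose g y := -1 * (u t (y + h) - u t y).
have r0 : 0 < 4 * D / L by rewrite divr_gt0// mulr_gt0.
have sg := @smooth_increment _ _ (-1) h st.
have := Lambda_at_max al sg (@periodic_increment _ _ (-1) h (pu t (ltW t0))) gmax r0.
rewrite -/g; set r := 4 * D / L in r0 *; set Lam := Lambda alpha g x => H.
have [i1 i2] := Rintegral_increment_le x ct (fun y => uD t y (ltW t0)) (ltW h0) (ltW r0).
have gx0 : 0 < g x by rewrite /g; have := mulr_gt0 L0 h0; lra.
have fdiff : derive1n 1 f (u t x) - derive1n 1 f (u t (x + h)) <= C2 * g x.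
  have uu : u t (x + h) <= u t x by move: gx0; rewrite /g; lra.
  have [c /andP[c1 c2] ->] := MVT_is_derive (fun y => smooth_is_derive 1 y sf) uu.
  have -> : u t x - u t (x + h) = g x by rewrite /g; ring.
  rewrite ler_wpM2r ?(ltW gx0)// f2// ler_norml.
  have := uD t x (ltW t0); have := uD t (x + h) (ltW t0).
  by rewrite !ler_norml => /andP[? ?] /andP[? ?]; apply/andP; split; lra.
have int_ge : r * g x / 2 <= \int[@lebesgue_measure R]_(y in `[r, 2 * r]) (g x - (g (x + y) + g (x - y)) / 2).
  have cgp : continuous (fun y => g (x + y)) by apply: continuous_comp_addr; exact: (@smooth_continuous _ _ 0 sg).
  have cgm : continuous (fun y => g (x - y)) by apply: continuous_comp_subr; exact: (@smooth_continuous _ _ 0 sg).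
  have -> : \int[@lebesgue_measure R]_(y in `[r, 2 * r]) (g x - (g (x + y) + g (x - y)) / 2) =
    \int[@lebesgue_measure R]_(y in `[r, 2 * r]) (g x + - 2^-1 * (g (x + y) + g (x - y))).
    by apply: eq_Rintegral => y _; congr (_ + _); rewrite mulNr mulrC.
  rewrite RintegralD_itv; last 2 first.
  - exact: continuous_const.
  - by apply: continuous_scale; exact: continuous_add.
  rewrite (RintegralZ_itv _ _ _ (continuous_add cgp cgm)) RintegralD_itv//.
  rewrite Rintegral_itv_cst; last by lra.
  have gE a : g a = u t a - u t (a + h) by rewrite /g; ring.
  under [X in - 2^-1 * (X + _)]eq_Rintegral do rewrite gE.
  under [X in - 2^-1 * (_ + X)]eq_Rintegral do rewrite gE.
  (* The origin of r = 4 D / L: since h < g x / L, the averaged neighbours take away at most half of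
     r * g x. *)
  have : 2 * D * h <= r * g x / 2.
    have -> : r * g x / 2 = 2 * D * (g x / L) by rewrite /r; field; rewrite gt_eqF.
    by rewrite ler_pM2l ?mulr_gt0// ler_pdivlMr// mulrC ltW.
  by move: i1 i2; lra.
have k0 := kappa_gt0 al.
(* Bounding the kernel from below at distance 2 r = 8 D / L and integrating over a length r gives (2
   r)^(-(1+alpha)) times r g x / 2, that is, (2 r)^(-alpha) g x / 4. *)
have key : g x * ((8 * D / L) `^ (- alpha) / 4) <= kappa alpha * Lam.
  apply: le_trans H.
  have r2 : 0 < 2 * r by rewrite mulr_gt0.
  apply: le_trans (ler_wpM2l (powR_ge0 _ _) int_ge).
  have -> : 8 * D / L = 2 * r by rewrite /r; field; rewrite gt_eqF.
  have -> : (2 * r) `^ (- alpha) = (2 * r) `^ (- (1 + alpha)) * (2 * r).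
    rewrite -{3}[2 * r]powRr1 ?(ltW r2)// -powRD ?(gt_eqF r2) ?implybT//.
    by congr (_ `^ _); ring.
  by rewrite le_eqVlt; apply/orP; left; apply/eqP; field.
rewrite subr_le0 -(ler_pM2l k0).
apply: (@le_trans _ _ (kappa alpha * (L * C2) * g x)).
  by rewrite -!mulrA ler_pM2l// ler_pM2l.
apply: le_trans (ler_wpM2r (ltW gx0) Lbig) _.
by rewrite [leRHS]mulrCA -[leLHS]mulrA ler_pM2l// mulrC.
Qed.

(** * Norms and moments of increments *)

Lemma lebesgue_measure_mono (R : realType) (A B : set R) :
  A `<=` B -> (@lebesgue_measure R A <= @lebesgue_measure R B)%E.
Proof. by move=> AB; exact: le_mu_ext. Qed.

Lemma circle_measureT (R : realType) : circle_measure R setT = 1%E.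
Proof.
rewrite /circle_measure/= /mrestr setTI lebesgue_measure_itv/= lte_fin ltr01.
by rewrite oppr0 adde0.
Qed.

(** By continuity a violation persists on an open interval. The measure only sees [0, 1], so the
    point is moved there and the interval clipped; it keeps positive length even at an endpoint. *)
Lemma ae_circle_le (R : realType) (v : R -> R) (M : R) :
  continuous v -> periodic1 v ->
  (\forall x \ae circle_measure R, `|v x| <= M) -> forall x, `|v x| <= M.
Proof.
move=> cv pv [N [mN N0 NM]] x; rewrite leNgt; apply/negP => Mx.
have [k /andP[k0 k1]] := periodic_reduce x.
move: Mx; rewrite -(periodicZ k x pv) => Mx; set x0 := x + k%:~R in k0 k1 Mx.
have cn : (fun y => `|v y|) @ x0 --> `|v x0| by apply: cvg_norm; exact: cv.
have [e /= e0 He] := cvgr_gt _ cn _ Mx.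
pose c := Num.max 0 (x0 - e); pose d := Num.min 1 (x0 + e).
have cd : c < d.
  by rewrite /c /d gt_max !lt_min; apply/andP; split; apply/andP; split; lra.
have sub : `]c, d[%classic `<=` N `&` `[0, 1].
  move=> y /=; rewrite !in_itv/= => /andP[].
  rewrite /c /d gt_max lt_min => /andP[y0 ye] /andP[y1 ye'].
  split; last by rewrite (ltW y0) (ltW y1).
  have hb : `|x0 - y| < e by rewrite ltr_distlC; apply/andP; split; lra.
  by apply: NM => /= vy; have := He y hb; rewrite /= ltNge vy.
have := lebesgue_measure_mono sub.
rewrite [X in (_ <= X)%E -> _](_ : _ = 0%E); last exact: N0.
rewrite lebesgue_measure_itv/= lte_fin cd -EFinD lee_fin; lra.
Qed.

Lemma norm_LpyE (R : realType) (v : R -> R) : continuous v -> periodic1 v ->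
  exists2 z, norm_Lp +oo%E v = `|v z| & forall x, `|v x| <= `|v z|.
Proof.
move=> cv pv.
have [z zmax] : exists z, forall x, `|v x| <= `|v z|.
  apply: periodic_max; first by move=> x; apply: cvg_norm; exact: cv.
  by move=> x; rewrite pv.
exists z => //.
suff E : 'N[circle_measure R]_+oo [EFin \o v]%E = `|v z|%:E by rewrite /norm_Lp E.
rewrite unlock circle_measureT lte01.
have T0 : (0 < circle_measure R setT)%E by rewrite circle_measureT.
set s := ess_sup _ _.
have s_le : (s <= `|v z|%:E)%E.
  apply/ess_supP; apply: nearW => x /=; rewrite lee_fin; exact: zmax.
have s_ge0 : (0 <= s)%E.
  by apply: ess_sup_gee => //; apply: nearW => x /=; rewrite lee_fin.
have s_fin : s \is a fin_num.
  by rewrite fin_numE gt_eqF ?lt_eqF ?(le_lt_trans s_le) ?ltry// (lt_le_trans _ s_ge0) ?ltNyr.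
apply/eqP; rewrite eq_le s_le/= -(fineK s_fin) lee_fin.
apply: (ae_circle_le cv pv).
have : (s <= (fine s)%:E)%E by rewrite fineK.
by move/ess_supP; apply: filterS => x /=; rewrite lee_fin.
Qed.

(** Differentiability of the power needs a positive base, so x = 0 is treated by hand; for p = 0 the
    convention that 0 to the power 0 is 1 makes the function constant. *)
Lemma continuous_abs_powR (R : realType) (p : R) : 0 <= p ->
  continuous (fun x : R => `|x| `^ p).
Proof.
rewrite le_eqVlt => /predU1P[<-|p0].
  by under eq_fun do rewrite powRr0; exact: continuous_const.
move=> x; have [->|x0] := eqVneq x 0.
  apply/cvgrPdist_le => e e0; rewrite normr0 powR0 ?gt_eqF//.
  have e1 : 0 < e `^ p^-1 by rewrite powR_gt0.
  apply/nbhs_ballP; exists (e `^ p^-1) => //= y.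
  rewrite /ball/= sub0r normrN => /ltW ye.
  rewrite sub0r normrN ger0_norm ?powR_ge0//.
  rewrite -[leRHS]powRr1 ?(ltW e0)// -(mulVf (lt0r_neq0 p0)) powRrM.
  by apply: ge0_ler_powR; rewrite ?nnegrE ?(ltW p0) ?powR_ge0.
apply: (@continuous_comp R R R (fun x => `|x|) (fun y => y `^ p)).
  exact: norm_continuous.
apply/differentiable_continuous/derivable1_diffP/derivable_powR.
by rewrite in_itv/= andbT normr_gt0.
Qed.

Lemma circle_int_ge (R : realType) (w : R -> R) (z a m : R) :
  continuous w -> periodic1 w -> (forall x, 0 <= w x) -> 0 <= a <= 1 ->
  (forall x, z <= x <= z + a -> m <= w x) -> a * m <= circle_int w.
Proof.
move=> cw pw w0 /andP[a0 a1] wm; rewrite -(@Rintegral_periodic_shift _ _ z cw pw).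
have cz : continuous (fun y => w (y + z)).
  by under eq_fun do rewrite addrC; exact: continuous_comp_addr.
apply: (@le_trans _ _ (\int[@lebesgue_measure R]_(y in `[0, a]) w (y + z))).
  rewrite -[a in a * m]subr0 mulrC -Rintegral_itv_cst//; apply: le_Rintegral_itv => //.
    exact: continuous_const.
  by move=> y /andP[y0 ya]; apply: wm; apply/andP; split; lra.
by apply: Rintegral_subset_itv.
Qed.

Lemma circle_int_le (R : realType) (f g : R -> R) :
  continuous f -> continuous g -> (forall x, f x <= g x) ->
  circle_int f <= circle_int g.
Proof. by move=> cf cg fg; apply: le_Rintegral_itv. Qed.

Lemma circle_intD (R : realType) (f g : R -> R) :
  continuous f -> continuous g ->
  circle_int (fun x => f x + g x) = circle_int f + circle_int g.
Proof. exact: RintegralD_itv. Qed.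

Lemma circle_intZ (R : realType) (f : R -> R) (c : R) : continuous f ->
  circle_int (fun x => c * f x) = c * circle_int f.
Proof. exact: RintegralZ_itv. Qed.

Lemma circle_int_increment (R : realType) (v : R -> R) (l : R) :
  continuous v -> periodic1 v -> circle_int (fun x => v (x + l) - v x) = 0.
Proof.
move=> cv pv; have cl : continuous (fun x => v (x + l)).
  by under eq_fun do rewrite addrC; exact: continuous_comp_addr.
have -> : (fun x => v (x + l) - v x) = (fun x => v (x + l) + -1 * v x).
  by apply/funext => x; rewrite mulN1r.
rewrite circle_intD//; last exact: continuous_scale.
by rewrite (circle_intZ _ cv) Rintegral_periodic_shift// mulN1r subrr.
Qed.

Definition incr_moment (R : realType) (v : R -> R) (p l : R) : R :=
  circle_int (fun x => `|v (x + l) - v x| `^ p).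

Lemma continuous_increment (R : realType) (v : R -> R) (l : R) :
  continuous v -> continuous (fun x => v (x + l) - v x).
Proof.
move=> cv; apply: continuous_sub => //.
by under eq_fun do rewrite addrC; exact: continuous_comp_addr.
Qed.

Lemma continuous_abs (R : realType) (v : R -> R) :
  continuous v -> continuous (fun x => `|v x|).
Proof. by move=> cv x; apply: cvg_norm; exact: cv. Qed.

Lemma continuous_incr_powR (R : realType) (v : R -> R) (p l : R) :
  continuous v -> 0 <= p -> continuous (fun x => `|v (x + l) - v x| `^ p).
Proof.
move=> cv p0 x.
apply: (@continuous_comp R R R (fun x => v (x + l) - v x) (fun y => `|y| `^ p)).
  exact: continuous_increment.
exact: continuous_abs_powR.
Qed.

(** An increment g <= D l satisfies |g| <= 2 D l - g, and g integrates to 0. *)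
Lemma incr_abs_le (R : realType) (v : R -> R) (D l : R) :
  continuous v -> periodic1 v -> (forall x, v (x + l) - v x <= D * l) ->
  0 <= D * l -> circle_int (fun x => `|v (x + l) - v x|) <= 2 * D * l.
Proof.
move=> cv pv vD Dl0; have cg := @continuous_increment _ _ l cv.
apply: (@le_trans _ _ (circle_int (fun x => 2 * D * l + -1 * (v (x + l) - v x)))).
  apply: circle_int_le; first exact: continuous_abs.
    by apply: continuous_add; [exact: continuous_const|exact: continuous_scale].
  by move=> x; have := vD x; rewrite ler_norml => h; apply/andP; split; lra.
rewrite circle_intD; [|exact: continuous_const|exact: continuous_scale].
by rewrite (circle_intZ _ cg) circle_int_increment// mulr0 addr0 circle_int_cst.
Qed.

(** In place of Jensen's inequality, the pointwise bound a^p <= l^p + l^(p-1) a is integrated; it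
    follows by comparing a with l. *)
Lemma incr_moment_le_lt1 (R : realType) (v : R -> R) (D p l : R) :
  continuous v -> periodic1 v -> 0 <= D -> 0 < l -> 0 <= p <= 1 ->
  circle_int (fun x => `|v (x + l) - v x|) <= 2 * D * l ->
  incr_moment v p l <= (1 + 2 * D) * l `^ p.
Proof.
move=> cv pv D0 l0 /andP[p0 p1] I1.
have lp : 0 < l `^ p by rewrite powR_gt0.
have ca := continuous_abs (@continuous_increment _ _ l cv).
apply: (@le_trans _ _ (circle_int (fun x => l `^ p + (l `^ p / l) * `|v (x + l) - v x|))).
  apply: circle_int_le.
  - exact: continuous_incr_powR.
  - by apply: continuous_add; [exact: continuous_const|exact: continuous_scale].
  move=> x; set a := `|_|; have a0 : 0 <= a := normr_ge0 _.
  have [al|la] := leP a l.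
    apply: (@le_trans _ _ (l `^ p)); first by apply: ge0_ler_powR; rewrite ?nnegrE ?(ltW l0).
    by rewrite lerDl mulr_ge0// divr_ge0 ?ltW.
  have -> : a = l * (a / l) by rewrite mulrC divfK// gt_eqF.
  have al1 : 1 <= a / l by rewrite ler_pdivlMr// mul1r ltW.
  rewrite powRM ?(ltW l0) ?(le_trans ler01)//.
  rewrite mulrA divfK ?gt_eqF// -[X in X + _]mulr1 -mulrDr ler_pM2l//.
  by apply: le_trans (ler1_powR al1 p1) _; rewrite lerDr.
rewrite circle_intD; [|exact: continuous_const|exact: continuous_scale].
rewrite (circle_intZ _ ca) circle_int_cst mulrDl mul1r lerD2l.
apply: le_trans (ler_wpM2l _ I1) _; first by rewrite divr_ge0 ?ltW.
have -> : l `^ p / l * (2 * D * l) = 2 * D * l `^ p by field; rewrite gt_eqF.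
by [].
Qed.

Lemma incr_moment_le_gt1 (R : realType) (v : R -> R) (D M p l : R) :
  continuous v -> periodic1 v -> 1 <= p ->
  circle_int (fun x => `|v (x + l) - v x|) <= 2 * D * l ->
  (forall x, `|v (x + l) - v x| <= M) ->
  incr_moment v p l <= 2 * D * l * M `^ (p - 1).
Proof.
move=> cv pv p1 I1 vM; have p0 : 0 < p := lt_le_trans ltr01 p1.
have ca := continuous_abs (@continuous_increment _ _ l cv).
apply: (@le_trans _ _ (circle_int (fun x => M `^ (p - 1) * `|v (x + l) - v x|))).
  apply: circle_int_le.
  - by apply: continuous_incr_powR => //; exact: ltW.
  - exact: continuous_scale.
  move=> x; rewrite -mulr_powRB1// mulrC ler_wpM2r//.
  by apply: ge0_ler_powR; rewrite ?nnegrE ?subr_ge0// (le_trans _ (vM x)).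
by rewrite (circle_intZ _ ca) mulrC ler_wpM2r// powR_ge0.
Qed.

(* Increments have zero mean, so their positive part carries half of the L_1
   norm, and it is at most D l. *)
Lemma incr_moment_ge_lt1 (R : realType) (v : R -> R) (D c p l : R) :
  continuous v -> periodic1 v -> 0 < D -> 0 < l -> 0 <= p <= 1 ->
  (forall x, v (x + l) - v x <= D * l) ->
  c * l <= circle_int (fun x => `|v (x + l) - v x|) ->
  c / 2 * D `^ (p - 1) * l `^ p <= incr_moment v p l.
Proof.
move=> cv pv D0 l0 /andP[p0 p1] vD I1.
have cg := @continuous_increment _ _ l cv; have ca := continuous_abs cg.
have Dl0 : 0 < D * l by rewrite mulr_gt0.
pose q := (D * l) `^ (p - 1); have q0 : 0 < q by rewrite powR_gt0.
(* The integrand is [q] times the positive part of the increment g. As p - 1 <= 0, g^(p-1) is at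
   least [q] whenever 0 < g <= D l. *)
apply: (@le_trans _ _ (circle_int (fun x => q / 2 * (`|v (x + l) - v x| + (v (x + l) - v x))))).
  rewrite (circle_intZ _ (continuous_add ca cg)) (circle_intD ca cg).
  rewrite (circle_int_increment l cv pv) addr0.
  have -> : c / 2 * D `^ (p - 1) * l `^ p = q / 2 * (c * l).
    rewrite /q powRM ?ltW//.
    have -> : l `^ p = l `^ (p - 1) * l.
      by rewrite -{3}[l]powRr1 ?ltW// -powRD ?(gt_eqF l0) ?implybT// subrK.
    by field.
  by rewrite ler_wpM2l// divr_ge0// ltW.
apply: circle_int_le.
- by apply: continuous_scale; exact: continuous_add.
- exact: continuous_incr_powR.
move=> x; have := vD x; set g := v (x + l) - v x => gD.
have [g0|g0] := leP g 0; first by rewrite ler0_norm// addNr mulr0 powR_ge0.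
rewrite gtr0_norm//.
have -> : q / 2 * (g + g) = q * g by field.
have -> : g `^ p = g `^ (p - 1) * g.
  by rewrite -{3}[g]powRr1 ?ltW// -powRD ?(gt_eqF g0) ?implybT// subrK.
rewrite ler_pM2r// /q -[p - 1]opprB !powRN lef_pV2 ?posrE ?powR_gt0//.
by apply: ge0_ler_powR; rewrite ?nnegrE ?(ltW g0) ?(ltW Dl0)// subr_ge0.
Qed.

(* In the next two lemmas B stands for nu^(-beta). *)
Lemma incr_moment_ge_small (R : realType) (v : R -> R) (K B z p l : R) :
  smooth v -> periodic1 v -> 1 < K -> 1 <= B -> 0 <= p ->
  B / K <= `|derive1n 1 v z| -> (forall x, `|derive1n 2 v x| <= K * B ^+ 2) ->
  0 < l <= (4 * K ^+ 2 * B)^-1 ->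
  (4 * K ^+ 2 * B)^-1 * (l * B / (2 * K)) `^ p <= incr_moment v p l.
Proof.
move=> sv pv K1 B1 p0 vz v2 /andP[l0 la]; set a := (4 * K ^+ 2 * B)^-1 in la *.
have K0 : 0 < K by lra. have B0 : 0 < B by lra.
have a0 : 0 < a by rewrite invr_gt0 !mulr_gt0// exprn_gt0.
(* The choice of [a]: mean value points lie within a + l <= 2 a of z, so the slope there differs
   from that at z by at most half of B / K. *)
have aK : K * B ^+ 2 * (2 * a) = B / K / 2 by rewrite /a; field; rewrite !gt_eqF.
have a1 : a <= 1 by rewrite invf_le1 ?mulr_gt0 ?exprn_gt0//; nra.
have cv : continuous v := @smooth_continuous _ _ 0 sv.
apply: (circle_int_ge (z := z)).
- exact: continuous_incr_powR.
- by move=> x; rewrite addrAC !pv.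
- by move=> x; rewrite powR_ge0.
- by rewrite (ltW a0).
move=> x /andP[zx xz].
apply: ge0_ler_powR; rewrite ?nnegrE//; first by rewrite divr_ge0 ?mulr_ge0//; lra.
have [|c /andP[c1 c2] ->] := MVT_is_derive (fun y => smooth_is_derive 0 y sv) (_ : x <= x + l).
  by rewrite lerDl ltW.
rewrite [x + l]addrC addrK normrM (gtr0_norm l0).
have -> : l * B / (2 * K) = B / (2 * K) * l by ring.
rewrite ler_pM2r//.
have zc : z <= c by lra.
have [e _ E] := MVT_is_derive (fun y => smooth_is_derive 1 y sv) zc.
have h1 : `|derive1n 1 v c - derive1n 1 v z| <= B / K / 2.
  by rewrite E normrM -aK ler_pM// ger0_norm ?subr_ge0//; lra.
have h2 : B / (2 * K) = B / K / 2 by field; rewrite gt_eqF.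
have := ler_normB (derive1n 1 v c) (derive1n 1 v c - derive1n 1 v z).
by rewrite subKr h2; lra.
Qed.

(* Near z the function drops by 3/32 K^(-3) over a length a/2 <= l/2, while its
   slope is at most K elsewhere. *)
Lemma incr_moment_ge_large (R : realType) (v : R -> R) (K B z p l : R) :
  smooth v -> periodic1 v -> 1 < K -> 6 * K ^+ 2 <= B -> 0 <= p ->
  B / K <= `|derive1n 1 v z| -> (forall x, `|derive1n 2 v x| <= K * B ^+ 2) ->
  (forall x, derive1n 1 v x <= K) ->
  (4 * K ^+ 2 * B)^-1 <= l <= 1 / 20 * K ^- 4 ->
  l / 2 * (25 * K ^+ 3)^-1 `^ p <= incr_moment v p l.
Proof.
move=> sv pv K1 B6 p0 vz v2 v1 /andP[al l2]; set a := (4 * K ^+ 2 * B)^-1 in al *.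
have K0 : 0 < K by lra. have B0 : 0 < B by nra.
have a0 : 0 < a by rewrite invr_gt0 !mulr_gt0// exprn_gt0.
have l0 : 0 < l by lra.
have aK : K * B ^+ 2 * a = B / K / 4 by rewrite /a; field; rewrite !gt_eqF.
(* A slope of size B / K exceeds the upper bound K on slopes, so the steep point z is a descent.
   This uses B >= 6 K^2. *)
have BK : K < B / K by rewrite ltr_pdivlMr//; nra.
have vz' : derive1n 1 v z <= - (B / K).
  have [z0|z0] := leP 0 (derive1n 1 v z).
    by move: vz; rewrite ger0_norm//; have := v1 z; lra.
  by move: vz; rewrite ltr0_norm//; lra.
have cv : continuous v := @smooth_continuous _ _ 0 sv.
(* The role of [C_2]: the possible rise K l <= 1/20 K^(-3) cannot undo the drop 3/32 K^(-3), and
   what is left is at least 1/25 K^(-3). *)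
have lK : K * l <= (20 * K ^+ 3)^-1.
  apply: le_trans (ler_wpM2l (ltW K0) l2) _.
  by rewrite le_eqVlt; apply/orP; left; apply/eqP; field; rewrite gt_eqF.
have l1 : l / 2 <= 1.
  have : K ^- 4 <= 1 by rewrite invf_le1 ?exprn_gt0// exprn_ege1// ltW.
  lra.
(* For x in [z - l/2, z] the interval [x, x + l] contains [z, z + a/2], because a <= l. *)
apply: (circle_int_ge (z := z - l / 2)).
- exact: continuous_incr_powR.
- by move=> x; rewrite addrAC !pv.
- by move=> x; rewrite powR_ge0.
- by rewrite l1 andbT divr_ge0// ltW.
move=> x /andP[zx xz].
apply: ge0_ler_powR; rewrite ?nnegrE// ?invr_ge0 ?mulr_ge0 ?exprn_ge0 ?(ltW K0)//.
have d0 (y : R) := smooth_is_derive 0 y sv.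
have up y y' : y <= y' -> v y' - v y <= K * (y' - y).
  move=> yy; have [c _ ->] := MVT_is_derive d0 yy.
  by rewrite ler_wpM2r ?subr_ge0//; exact: v1.
have drop : v (z + a / 2) - v z <= - (3 / 4 * (B / K)) * (a / 2).
  have [|c /andP[c1 c2] ->] := MVT_is_derive d0 (_ : z <= z + a / 2); first by rewrite lerDl; lra.
  rewrite [z + _]addrC addrK ler_wpM2r//; first by lra.
  have [e _ E] := MVT_is_derive (fun y => smooth_is_derive 1 y sv) c1.
  have h1 : derive1n 1 v c - derive1n 1 v z <= B / K / 4.
    rewrite E -aK; apply: le_trans (ler_norm _) _; rewrite normrM.
    by rewrite ler_pM// ger0_norm ?subr_ge0//; lra.
  lra.
have aBK : 3 / 4 * (B / K) * (a / 2) = 3 / 32 * (K ^+ 3)^-1.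
  by rewrite /a; field; rewrite !gt_eqF.
have K3 : 0 < (K ^+ 3)^-1 by rewrite invr_gt0 exprn_gt0.
rewrite -normrN; apply: le_trans (ler_norm _).
have u1 := up x z; have u2 := up (z + a / 2) (x + l).
rewrite !invfM in lK *.
have : v z - v x <= K * (z - x) by apply: u1; lra.
have : v (x + l) - v (z + a / 2) <= K * (x + l - (z + a / 2)) by apply: u2; lra.
have Ka : 0 < K * a by rewrite mulr_gt0.
move: drop; rewrite mulNr aBK; lra.
Qed.

(** * Time averages *)

(** [A'] is a continuous function on the line that agrees with [A] on [a, b]; it supplies the
    integrability, since [A] may be arbitrary at negative times. *)
Lemma time_average_le (R : realType) (a b M : R) (A A' : R -> R) :
  a < b -> continuous A' -> (forall t, a <= t <= b -> A t = A' t) ->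
  (forall t, a <= t <= b -> A t <= M) -> time_average a b A <= M.
Proof.
move=> ab cA AA' AM; have ba : 0 < b - a by rewrite subr_gt0.
rewrite /time_average mul1r ler_pdivrMl// mulrC -(Rintegral_itv_cst _ (ltW ab)).
rewrite (@eq_Rintegral _ _ R (@lebesgue_measure R) _ A'); last by move=> t; rewrite inE/= in_itv; exact: AA'.
apply: le_Rintegral_itv => //; first exact: continuous_const.
by move=> t t_; rewrite -AA'// AM.
Qed.

(* Chebyshev on the superlevel set [m <= A'], which is measurable even if E is
   not. *)
Lemma time_average_ge (R : realType) (a b m C : R) (A A' : R -> R) (E : set R) :
  a < b -> continuous A' -> (forall t, a <= t <= b -> A t = A' t) ->
  (forall t, 0 <= A' t) -> 0 < m ->
  (forall t, E t -> a <= t <= b /\ m <= A t) ->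
  (C%:E <= @lebesgue_measure R E)%E ->
  C / (b - a) * m <= time_average a b A.
Proof.
move=> ab cA AA' A0 m0 EA CE; have ba : 0 < b - a by rewrite subr_gt0.
rewrite /time_average mul1r mulrAC -mulrC ler_pM2l ?invr_gt0//.
rewrite (@eq_Rintegral _ _ R (@lebesgue_measure R) _ A'); last by move=> t; rewrite inE/= in_itv; exact: AA'.
rewrite mulrC.
have mI : measurable (`[a, b]%classic : set R) by exact: measurable_itv.
have iA := @continuous_integrable_itv R A' a b cA.
have mA := measurable_int _ iA.
have := @le_integral_abse _ _ _ (@lebesgue_measure R) _ mI _ m mA m0.
set F := `[a, b] `&` _ => cheb.
have EF : E `<=` F.
  move=> t /EA[tab mt]; split; first by rewrite /= in_itv.
  by rewrite /= lee_fin ger0_norm// -AA'.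
rewrite -lee_fin; apply: (@le_trans _ _ (m%:E * lebesgue_measure F)%E).
  by rewrite EFinM lee_pmul2l// (le_trans CE)// lebesgue_measure_mono.
apply: le_trans cheb _; rewrite /Rintegral fineK; last exact: integrable_fin_num.
rewrite le_eqVlt; apply/orP; left; apply/eqP; apply: eq_integral => t _ /=.
by rewrite ger0_norm.
Qed.

Lemma continuous_incr_moment (R : realType) (u : R -> R -> R) (D p l : R) :
  smooth_spacetime u -> (forall t x, 0 <= t -> `|u t (x + l) - u t x| <= D) ->
  0 <= p -> continuous (fun t : R => incr_moment (u `|t|) p l).
Proof.
move=> su uD p0 t0.
have cU := continuous_spacetime su.
have cu (t : R) : continuous (u `|t|) by exact: (@smooth_continuous _ _ 0 (smooth_slice su (normr_ge0 t))).
pose F (t x : R) := `|u `|t| (x + l) - u `|t| x| `^ p.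
have ct x : continuous (fun t : R => u `|t| x).
  move=> t; apply: (@cvg_comp _ _ _ (fun t : R => (t, x)) (fun z : R * R => u `|z.1| z.2) _ _ _ _ (cU (t, x))).
  have c1 : (fun t : R => t) @ t --> t by exact: cvg_id.
  have c2 : (fun _ : R => x) @ t --> x by exact: cvg_cst.
  exact: cvg_pair c1 c2.
have cF x : continuous (F ^~ x).
  move=> t; apply: (@continuous_comp R R R (fun t : R => u `|t| (x + l) - u `|t| x) (fun y => `|y| `^ p)).
    by apply: (@continuous_sub R (fun t : R => u `|t| (x + l)) (fun t : R => u `|t| x)); exact: ct.
  exact: continuous_abs_powR.
have D0 : 0 <= D := le_trans (normr_ge0 _) (uD 0 0 (lexx 0)).
have := @continuity_under_integral R _ _ (@lebesgue_measure R) F `[0, 1] (measurable_itv _)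
  (t0 - 1) (t0 + 1) _ _ (fun=> D `^ p) _ _ t0.
apply.
- by move=> t _; apply: continuous_integrable_itv; exact: continuous_incr_powR.
- by apply: aeW => x _ t _; exact: cF.
- by apply: (@continuous_integrable_itv R (fun=> D `^ p)); exact: continuous_const.
- move=> t _; apply: aeW => x _; rewrite ger0_norm ?powR_ge0//.
  by apply: ge0_ler_powR; rewrite ?nnegrE// uD.
- by rewrite inE/= in_itv/=; apply/andP; split; lra.
Qed.

(** * Uniform bounds for admissible solutions, and the final estimates *)

Lemma norm_W_y_le (R : realType) (v : R -> R) (m : nat) (M : R) :
  smooth v -> periodic1 v -> norm_W m +oo%E v <= M ->
  forall x, `|derive1n m v x| <= M.
Proof.
move=> sv pv; rewrite /norm_W.
have [z -> zmax] := norm_LpyE (@smooth_continuous _ _ m sv) (@periodic_derive1n _ _ m pv).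
by move=> zM x; exact: le_trans (zmax x) zM.
Qed.

Lemma norm_W_y_ge (R : realType) (v : R -> R) (m : nat) (M : R) :
  smooth v -> periodic1 v -> M <= norm_W m +oo%E v ->
  exists z, M <= `|derive1n m v z|.
Proof.
move=> sv pv; rewrite /norm_W.
have [z -> _] := norm_LpyE (@smooth_continuous _ _ m sv) (@periodic_derive1n _ _ m pv).
by exists z.
Qed.

(** [A] is fixed before nu, u0 and u, which gives the required uniformity. The bound |u| <= D
    confines f'' to a fixed compact range, where the growth condition bounds it by [C2]. *)
Lemma admissible_bounds (R : realType) (alpha : R) (f : R -> R) (sigma D : R) :
  1 < alpha < 2 -> flux_condition f sigma -> 1 < D ->
  exists2 A, D <= A & forall nu u0 u, admissible alpha f D nu u0 u ->
    forall t, 0 <= t ->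
    [/\ smooth (u t) /\ periodic1 (u t),
        forall x h, 0 <= h <= 1 -> u t (x + h) - u t x <= D * h,
        forall x h, 0 <= h <= 1 ->
          `|u t (x + h) - u t x| <= A * nu `^ (- beta alpha) * h &
        forall x y, `|u t x - u t y| <= D].
Proof.
move=> al [sf sig0 f2 [h [Cf [h0 Cf0 fC _]]]] D1; have D0 : 0 < D by lra.
pose C2 := Cf 2%N * (1 + D) `^ h 2%N.
have C20 : 0 < C2 by rewrite mulr_gt0// powR_gt0//; lra.
have f2le x : `|x| <= D -> derive1n 2 f x <= C2.
  move=> xD; apply: le_trans (ler_norm _) _; apply: le_trans (fC 2%N x) _.
  by rewrite ler_pM2l//; apply: ge0_ler_powR; rewrite ?nnegrE ?addr_ge0 ?lerD2l// ltW.
have k0 := kappa_gt0 al.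
(* With B = nu^(-beta), so that B^(alpha-1) = 1/nu, the condition of [lower_slope] for L = A B
   reduces to Q <= A^(alpha-1), that is, Q^beta <= A. Requiring also D <= A makes L dominate the
   initial slopes, as B >= 1. *)
pose Q := 4 * kappa alpha * (8 * D) `^ alpha * C2.
have P0 : 0 < (8 * D) `^ alpha by rewrite powR_gt0 ?mulr_gt0.
have Q0 : 0 < Q by do 2!apply: mulr_gt0 => //; exact: mulr_gt0.
pose A := Num.max D (Q `^ beta alpha).
have AD : D <= A by rewrite le_max lexx.
have A0 : 0 < A := lt_le_trans D0 AD.
exists A => // nu u0 u [/andP[nu0 nu1] [pu0 su0 mu0 _] Du0 sol] t t0.
have [pu su mu pde ui] := sol.
have u0D x : `|derive1n 1 u0 x| <= D.
  by apply: norm_W_y_le => //; rewrite -Du0 le_max lexx orbT.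
have ole := oleinik al sf sig0 f2 nu0 D0 su0 (fun x => le_trans (ler_norm _) (u0D x)) sol.
have osc s : 0 <= s -> forall x y, u s x - u s y <= D.
  move=> s0; apply: periodic_osc_le; last exact: ltW.
  - exact: (@smooth_continuous _ _ 0 (smooth_slice su s0)).
  - exact: pu.
  - by move=> x k; exact: ole.
have supu s x : 0 <= s -> `|u s x| <= D.
  move=> s0; apply: zero_mean_sup_le; last exact: osc.
  - exact: (@smooth_continuous _ _ 0 (smooth_slice su s0)).
  - exact: mu.
have [al1 _] := andP al; have a1 : 0 < alpha - 1 by rewrite subr_gt0.
have b0 : 0 < beta alpha by rewrite divr_gt0.
pose B := nu `^ (- beta alpha).
have B1 : 1 <= B.
  rewrite /B powRN invf_ge1 ?powR_gt0//.
  have := @ge0_ler_powR R _ (ltW b0) nu 1; rewrite powR1.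
  by apply; rewrite ?nnegrE ?ler01 ?(ltW nu0).
have B0 : 0 < B := lt_le_trans ltr01 B1.
have L0 : 0 < A * B by rewrite mulr_gt0.
have DL : D <= A * B by rewrite (le_trans AD)// ler_peMr// ltW.
have slope : kappa alpha * (A * B * C2) <= nu * ((8 * D / (A * B)) `^ (- alpha) / 4).
  have AQ : Q <= A `^ (alpha - 1).
    have -> : Q = (Q `^ beta alpha) `^ (alpha - 1).
      by rewrite -powRrM /beta div1r mulVf ?gt_eqF// powRr1 ?ltW.
    by apply: ge0_ler_powR; rewrite ?nnegrE ?powR_ge0 ?(ltW a1) ?(ltW A0)// le_max lexx orbT.
  have BE : B `^ (alpha - 1) = nu^-1.
    by rewrite /B -powRrM /beta mulNr div1r mulVf ?gt_eqF// powR_inv1 ?ltW.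
  have AB0 : 0 <= A * B := ltW L0.
  have -> : (8 * D / (A * B)) `^ (- alpha) = (A * B) `^ (alpha - 1) * (A * B) / (8 * D) `^ alpha.
    have D8 : 0 <= 8 * D by rewrite mulr_ge0// ltW.
    have ABi : 0 <= (A * B)^-1 by rewrite invr_ge0.
    rewrite powRM// mulrC [(8 * D) `^ _]powRN; congr (_ / _).
    rewrite -{3}[A * B]powRr1// -powRD ?(gt_eqF L0) ?implybT// subrK.
    by rewrite -powR_inv1// -powRrM mulN1r opprK.
  rewrite [(A * B) `^ _]powRM ?(ltW A0) ?(ltW B0)// BE.
  have -> : nu * (A `^ (alpha - 1) / nu * (A * B) / (8 * D) `^ alpha / 4) =
      A `^ (alpha - 1) * (A * B / (4 * (8 * D) `^ alpha)).
    by field; rewrite !gt_eqF.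
  have -> : kappa alpha * (A * B * C2) = Q * (A * B / (4 * (8 * D) `^ alpha)).
    by rewrite /Q; field; rewrite gt_eqF.
  by rewrite ler_pM2r// divr_gt0// mulr_gt0.
have low := lower_slope al sf (ltW C20) f2le nu0 D0 su0
  (fun x => _ : - (A * B) <= derive1 u0 x) sol supu L0 slope.
split => //.
- by split; [exact: smooth_slice|exact: pu].
- by move=> x k; exact: ole.
- move=> x k /[dup] k01 /andP[k0' _]; rewrite -/B ler_norml; apply/andP; split.
    rewrite lerNl opprB; apply: low => // y.
    by have := u0D y; rewrite ler_norml => /andP[h1 _]; apply: le_trans h1; rewrite lerN2.
  by apply: le_trans (ole t x k t0 k01) _; rewrite ler_wpM2r.
- by move=> x y; rewrite ler_norml lerNl opprB !osc.
Qed.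

Lemma L_set_pointwise (R : realType) (alpha sigma D Ct nu K : R) (u : R -> R -> R) (t : R) :
  0 < nu -> smooth (u t) -> periodic1 (u t) ->
  L_set alpha sigma D Ct nu u K t ->
  [/\ exists z, nu `^ (- beta alpha) / K <= `|derive1n 1 (u t) z|,
      forall x, `|derive1n 2 (u t) x| <= K * (nu `^ (- beta alpha)) ^+ 2 &
      forall x, derive1n 1 (u t) x <= K].
Proof.
move=> nu0 sv pv [_ [_ _ dxK] /andP[v1 _] v2]; split.
- have [z zv] := norm_W_y_ge sv pv v1.
  by exists z; rewrite mulrC.
- rewrite -powR_mulrn ?powR_ge0// -powRrM mulNr [_ * 2]mulrC.
  exact: norm_W_y_le.
(* The supremum dominates every slope only once the range is known to be bounded; periodicity
   provides this. *)
- move=> x; apply: le_trans dxK; apply: ub_le_sup; last by exists x.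
  have [M _ vM] := periodic_bounded (@smooth_continuous _ _ 1 sv) (@periodic_derive1n _ _ 1 pv).
  by exists M => _ [y _ <-]; exact: le_trans (ler_norm _) (vM y).
Qed.

(** The choice of [nu_0] expressed through B = nu^(-beta): it is what separates the steep slopes, at
    least B / K in size, from the upper bound K. *)
Lemma nu_0_powR (R : realType) (alpha nu K : R) : 1 < alpha < 2 -> 0 < nu ->
  0 < K -> nu <= nu_0 alpha K -> 6 * K ^+ 2 <= nu `^ (- beta alpha).
Proof.
move=> /andP[al1 _] nu0 K0 nuK.
have b0 : 0 < beta alpha by rewrite divr_gt0// subr_gt0.
have K2 : 0 < 1 / 6 * K ^- 2 by rewrite mulr_gt0 ?divr_gt0 ?invr_gt0 ?exprn_gt0.
have h : nu `^ beta alpha <= 1 / 6 * K ^- 2.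
  have E : nu_0 alpha K `^ beta alpha = 1 / 6 * K ^- 2.
    by rewrite /nu_0 -powRrM [1 / beta alpha]div1r mulVf ?gt_eqF// powRr1 ?(ltW K2).
  by rewrite -E; apply: ge0_ler_powR; rewrite ?nnegrE ?powR_ge0 ?(ltW b0) ?(ltW nu0).
rewrite powRN -[leLHS]invrK lef_pV2 ?posrE ?invr_gt0 ?powR_gt0 ?mulr_gt0 ?exprn_gt0//.
suff -> : (6 * K ^+ 2)^-1 = 1 / 6 * K ^- 2 by [].
by field; rewrite gt_eqF.
Qed.

Lemma incr_moment1 (R : realType) (v : R -> R) (l : R) :
  incr_moment v 1 l = circle_int (fun x => `|v (x + l) - v x|).
Proof. by rewrite /incr_moment; congr circle_int; apply/funext => x; rewrite powRr1. Qed.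

Lemma incr_moment_ge0 (R : realType) (v : R -> R) (p l : R) :
  0 <= incr_moment v p l.
Proof. by apply: Rintegral_ge0 => x _; exact: powR_ge0. Qed.

Lemma sim_of_bounds (R : realType) (c X Y M m : R) :
  0 <= Y -> 0 < m -> X <= M * Y -> m * Y <= X -> M <= c -> m^-1 <= c ->
  sim_with c X Y.
Proof.
move=> Y0 m0 XM mX Mc mc; split; first by apply: le_trans XM _; rewrite ler_wpM2r.
have X0 : 0 <= X by apply: le_trans mX; rewrite mulr_ge0// ltW.
by apply: le_trans (ler_wpM2r X0 mc); rewrite ler_pdivlMl.
Qed.

Theorem theorem7p6 (R : realType) (alpha : R) (f : R -> R)
    (sigma D Ct C K : R) :
  1 < alpha < 2 ->
  flux_condition f sigma ->
  1 < D ->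
  energy_constant alpha f D Ct ->
  L_constants alpha f sigma D Ct C K ->
  forall p : R, 0 <= p ->
  exists c : R, 0 < c /\
    forall (nu : R) (u0 : R -> R) (u : R -> R -> R),
      admissible alpha f D nu u0 u ->
      nu <= nu_0 alpha K ->
      (forall l : R, 0 < l <= C_1 K * nu `^ (beta alpha) ->
         (p <= 1 ->
            sim_with c (structure_function sigma D Ct u p l) (l `^ p)) /\
         (1 <= p ->
            sim_with c (structure_function sigma D Ct u p l)
              (l `^ p * nu `^ (- (beta alpha * (p - 1)))))) /\
      (forall l : R, C_1 K * nu `^ (beta alpha) < l <= C_2 K ->
         (p <= 1 ->
            sim_with c (structure_function sigma D Ct u p l) (l `^ p)) /\
         (1 <= p ->
            sim_with c (structure_function sigma D Ct u p l) l)).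
Proof.
move=> al flux D1 [Ct0 _] [C0 K1 LK] p p0.
have D0 : 0 < D by lra.
have [A AD bounds] := admissible_bounds al flux D1.
have A0 : 0 < A := lt_le_trans D0 AD.
have K0 : 0 < K by lra.
pose a := T1 D Ct; pose b := T2 sigma D Ct.
have a0 : 0 < a by rewrite /a /T1 !mulr_gt0 ?invr_gt0 ?exprn_gt0.
have ab : a < b by rewrite /b /T2 lt_max -/a; apply/orP; left; lra.
pose tau := C / (b - a).
have tau0 : 0 < tau by rewrite divr_gt0// subr_gt0.
have K3 : 0 < K ^+ 3 by rewrite exprn_gt0.
(* The smaller of the two lower constants for p = 1: 1/(8 K^3) from the small increments and 1/(50
   K^3) from the large ones. *)
pose c1 := (50 * K ^+ 3)^-1; have c10 : 0 < c1 by rewrite invr_gt0 mulr_gt0.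
(* Index 1 serves p <= 1 on both ranges of l, index 2 serves p >= 1 on the small range, and index 3
   serves p >= 1 on the large range. *)
pose M1 := 1 + 2 * D; pose M2 := 2 * D * A `^ (p - 1); pose M3 := 2 * D * D `^ (p - 1).
pose m1 := c1 / 2 * D `^ (p - 1).
pose m2 := (4 * K ^+ 2)^-1 * (2 * K)^-1 `^ p.
pose m3 := 2^-1 * (25 * K ^+ 3)^-1 `^ p.
have M10 : 0 < M1 by rewrite /M1; lra.
have M20 : 0 < M2 by rewrite mulr_gt0 ?powR_gt0 ?mulr_gt0.
have M30 : 0 < M3 by rewrite mulr_gt0 ?powR_gt0 ?mulr_gt0.
have m10 : 0 < m1 by rewrite mulr_gt0 ?powR_gt0 ?divr_gt0.
have m20 : 0 < m2 by rewrite mulr_gt0 ?powR_gt0 ?invr_gt0 ?mulr_gt0 ?exprn_gt0.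
have m30 : 0 < m3 by rewrite mulr_gt0 ?powR_gt0 ?invr_gt0 ?mulr_gt0 ?exprn_gt0.
have n1 : 0 < (tau * m1)^-1 by rewrite invr_gt0; exact: mulr_gt0.
have n2 : 0 < (tau * m2)^-1 by rewrite invr_gt0; exact: mulr_gt0.
have n3 : 0 < (tau * m3)^-1 by rewrite invr_gt0; exact: mulr_gt0.
pose c := M1 + M2 + M3 + (tau * m1)^-1 + (tau * m2)^-1 + (tau * m3)^-1.
have cM1 : M1 <= c by rewrite /c; lra.
have cM2 : M2 <= c by rewrite /c; lra.
have cM3 : M3 <= c by rewrite /c; lra.
have cm1 : (tau * m1)^-1 <= c by rewrite /c; lra.
have cm2 : (tau * m2)^-1 <= c by rewrite /c; lra.
have cm3 : (tau * m3)^-1 <= c by rewrite /c; lra.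
exists c; split; first by apply: lt_le_trans cM1.
move=> nu u0 u adm nuK; have [/andP[nu0 _] _ _ [_ su _ _ _]] := adm.
have bd := bounds nu u0 u adm.
have LKm := LK K (lexx K) nu u0 u adm.
have B6 := nu_0_powR al nu0 K0 nuK.
have nuB : nu `^ beta alpha = (nu `^ (- beta alpha))^-1 by rewrite powRN invrK.
have nuBp : nu `^ (- (beta alpha * (p - 1))) = (nu `^ (- beta alpha)) `^ (p - 1).
  by rewrite -powRrM mulNr.
have facts t : 0 <= t -> L_set alpha sigma D Ct nu u K t -> _ :=
  fun t0 => let: And4 (conj sv pv) _ _ _ := bd t t0 in L_set_pointwise nu0 sv pv.
rewrite nuB nuBp.
move: (nu `^ (- beta alpha)) B6 bd facts {nuB nuBp} => B B6 bd facts.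
have K21 : 1 <= K ^+ 2 by rewrite exprn_ege1// ltW.
have B1 : 1 <= B by lra.
have B0 : 0 < B by lra.
have Lab t : L_set alpha sigma D Ct nu u K t -> a <= t <= b by case.
(* Each case is reduced to an upper bound at every time and a lower bound at the times of [L_set];
   the latter loses the factor [tau], a lower bound for the proportion of such times. *)
have core l Y M m : 0 <= l <= 1 -> 0 < Y -> 0 < m ->
    (forall t, 0 <= t -> incr_moment (u t) p l <= M * Y) ->
    (forall t, 0 <= t -> L_set alpha sigma D Ct nu u K t -> m * Y <= incr_moment (u t) p l) ->
    M <= c -> (tau * m)^-1 <= c -> sim_with c (structure_function sigma D Ct u p l) Y.
  move=> l01 Y0 m0 up low Mc mc.
  have cA : continuous (fun t : R => incr_moment (u `|t|) p l).
    apply: (@continuous_incr_moment R u D) => // t x t0.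
    by have [_ _ _ ->] := bd t t0.
  have AA' t : a <= t <= b -> incr_moment (u t) p l = incr_moment (u `|t|) p l.
    by move=> /andP[at_ _]; rewrite ger0_norm// (le_trans (ltW a0)).
  apply: (sim_of_bounds (ltW Y0) _ _ _ Mc mc); first exact: mulr_gt0.
    apply: (time_average_le ab cA AA') => t /andP[at_ _].
    by apply: up; exact: le_trans (ltW a0) at_.
  rewrite -mulrA; apply: (time_average_ge ab cA AA' _ _ _ LKm).
  - by move=> t; exact: incr_moment_ge0.
  - exact: mulr_gt0.
  - move=> t Lt; have abt := Lab t Lt; split => //; apply: low => //.
    by case/andP: abt => at_ _; exact: le_trans (ltW a0) at_.
have cont t : 0 <= t -> continuous (u t).
  by move=> t0; have [[sv _] _ _ _] := bd t t0; exact: (@smooth_continuous _ _ 0 sv).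
have per t : 0 <= t -> periodic1 (u t) by move=> t0; have [[_ pv] _ _ _] := bd t t0.
have I1 t l : 0 <= t -> 0 <= l <= 1 -> circle_int (fun x => `|u t (x + l) - u t x|) <= 2 * D * l.
  move=> t0 /[dup] l01 /andP[l0 _]; have [_ sl _ _] := bd t t0.
  apply: (incr_abs_le (cont t t0) (per t t0)); last by rewrite mulr_ge0// ltW.
  by move=> x; exact: sl.
have up1 l t : 0 < l <= 1 -> p <= 1 -> 0 <= t -> incr_moment (u t) p l <= M1 * l `^ p.
  move=> /andP[l0 l1] p1 t0; apply: incr_moment_le_lt1 => //.
  - exact: cont.
  - exact: per.
  - exact: ltW.
  - by rewrite p0.
  - by apply: I1; rewrite ?(ltW l0).
have low1 l t : 0 < l <= 1 -> p <= 1 -> 0 <= t -> c1 * l <= incr_moment (u t) 1 l ->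
    m1 * l `^ p <= incr_moment (u t) p l.
  move=> /andP[l0 l1] p1 t0; rewrite incr_moment1 => h.
  have [_ sl _ _] := bd t t0.
  apply: incr_moment_ge_lt1 h => //.
  - exact: cont.
  - exact: per.
  - by rewrite p0.
  - by move=> x; apply: sl; rewrite (ltW l0).
have small l t q : 0 < l <= (4 * K ^+ 2 * B)^-1 -> 0 <= q -> 0 <= t ->
    L_set alpha sigma D Ct nu u K t ->
    (4 * K ^+ 2 * B)^-1 * (l * B / (2 * K)) `^ q <= incr_moment (u t) q l.
  move=> lB q0 t0 Lt; have [[sv pv] _ _ _] := bd t t0.
  by have [[z vz] v2 v1] := facts t t0 Lt; exact: incr_moment_ge_small vz v2 lB.
have large l t q : (4 * K ^+ 2 * B)^-1 <= l <= 1 / 20 * K ^- 4 -> 0 <= q -> 0 <= t ->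
    L_set alpha sigma D Ct nu u K t ->
    l / 2 * (25 * K ^+ 3)^-1 `^ q <= incr_moment (u t) q l.
  move=> lB q0 t0 Lt; have [[sv pv] _ _ _] := bd t t0.
  by have [[z vz] v2 v1] := facts t t0 Lt; exact: incr_moment_ge_large vz v2 v1 lB.
have C1E : C_1 K * B^-1 = (4 * K ^+ 2 * B)^-1 by rewrite /C_1; field; rewrite !gt_eqF.
have KB : (4 * K ^+ 2 * B)^-1 <= 1.
  by rewrite invf_le1 ?mulr_gt0 ?exprn_gt0//; nra.
rewrite C1E; split=> l /andP[l0 lC].
- have l01 : 0 < l <= 1 by rewrite l0 (le_trans lC).
  have l01' : 0 <= l <= 1 by rewrite (ltW l0) (le_trans lC).
  have lB : 0 < l <= (4 * K ^+ 2 * B)^-1 by rewrite l0.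
  split=> p1.
  + apply: (core l _ M1 m1) => //; first exact: powR_gt0.
      by move=> t t0; exact: up1.
    move=> t t0 Lt; apply: low1 => //; apply: le_trans (small l t 1 lB ler01 t0 Lt).
    rewrite powRr1 ?divr_ge0 ?mulr_ge0 ?(ltW l0) ?(ltW B0) ?(ltW K0)//.
    have -> : (4 * K ^+ 2 * B)^-1 * (l * B / (2 * K)) = (8 * K ^+ 3)^-1 * l.
      by field; rewrite !gt_eqF.
    by rewrite ler_pM2r// lef_pV2 ?posrE ?mulr_gt0// ler_pM2r// ler_nat.
  + have pp : 0 < p by lra.
    have lpE : l `^ p = l `^ (p - 1) * l by rewrite -(mulr_powRB1 (ltW l0) pp) mulrC.
    apply: (core l _ M2 m2) => //; first by rewrite mulr_gt0 ?powR_gt0.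
      move=> t t0; have [_ _ sl _] := bd t t0.
      apply: le_trans (incr_moment_le_gt1 (cont t t0) (per t t0) p1 (I1 t l t0 l01') (fun x => sl x l l01')) _.
      rewrite /M2 !powRM ?mulr_ge0 ?(ltW A0) ?(ltW B0) ?(ltW l0)// lpE.
      rewrite le_eqVlt; apply/orP; left; apply/eqP; ring.
    move=> t t0 Lt; apply: le_trans (small l t p lB p0 t0 Lt).
    rewrite powRM ?mulr_ge0 ?invr_ge0 ?(ltW l0) ?(ltW B0) ?mulr_ge0 ?(ltW K0)//.
    rewrite powRM ?(ltW l0) ?(ltW B0)// /m2.
    have -> : B `^ p = B * B `^ (p - 1) by rewrite mulr_powRB1 ?ltW.
    by rewrite le_eqVlt; apply/orP; left; apply/eqP; field; rewrite !gt_eqF.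
- have lC' : l <= 1 / 20 * K ^- 4 := lC.
  have l00 : 0 < l by apply: lt_trans l0; rewrite invr_gt0 !mulr_gt0// exprn_gt0.
  have l1 : l <= 1.
    have : K ^- 4 <= 1 by rewrite invf_le1 ?exprn_gt0// exprn_ege1// ltW.
    lra.
  have l01 : 0 < l <= 1 by rewrite l00.
  have l01' : 0 <= l <= 1 by rewrite (ltW l00).
  have lB : (4 * K ^+ 2 * B)^-1 <= l <= 1 / 20 * K ^- 4 by rewrite (ltW l0).
  split=> p1.
  + apply: (core l _ M1 m1) => //; first exact: powR_gt0.
      by move=> t t0; exact: up1.
    move=> t t0 Lt; apply: low1 => //; apply: le_trans (large l t 1 lB ler01 t0 Lt).
    rewrite powRr1; last by rewrite invr_ge0 ltW// mulr_gt0.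
    by rewrite le_eqVlt; apply/orP; left; apply/eqP; rewrite /c1; field; rewrite gt_eqF.
  + apply: (core l l M3 m3) => //.
      move=> t t0; have [_ _ _ sl] := bd t t0.
      apply: le_trans (incr_moment_le_gt1 (cont t t0) (per t t0) p1 (I1 t l t0 l01') (fun x => sl _ _)) _.
      by rewrite /M3; rewrite le_eqVlt; apply/orP; left; apply/eqP; ring.
    move=> t t0 Lt; apply: le_trans (large l t p lB p0 t0 Lt).
    by rewrite /m3; rewrite le_eqVlt; apply/orP; left; apply/eqP; ring.
Qed.
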